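(* (A) Let $k>0$ be an integer and let $\alpha\in\mathbb{Q}^{2k}$ be a ration. If $k(j-1)<d-1$, then for every collection $\mathcal{M}=\{\mu_1,\dots,\mu_j\}$ of $j$ measures on the sphere $S^{d-1}$ there exists an $\alpha$-partition of $\mathcal{M}$ by a $2k$-fan. (B) Let $k>0$ be an integer and let $\alpha\in\mathbb{Q}^{2k}$ be a ration. If $kj<d-1$, then for every collection $\mathcal{M}=\{\mu_1,\dots,\mu_j\}$ of $j$ measures on the sphere $S^{d-1}$ there exists an $\alpha$-partition of $\mathcal{M}$ by an arrangement in $k$-fan position.
   Context: Measure: throughout, a measure on $S^{d-1}\subset\mathbb{R}^d$ is a Borel probability measure $\mu$ that is proper, i.e. $\mu(H\cap S^{d-1})=0$ for every hyperplane $H\subset\mathbb{R}^d$ and $\mu(U)>0$ for every non-empty open set $U\subseteq S^{d-1}$. Ration: a vector $\alpha=(\alpha_1,\dots,\alpha_{2k})\in\mathbb{Q}^{2k}$ with $\alpha_i>0$ and $\alpha_i=\alpha_{k+i}$ for all $i\in\{1,\dots,k\}$, and $\sum_{i=1}^k\alpha_i=\tfrac12$. Fans: if $H$ is a (linear) hyperplane in $\mathbb{R}^d$ and $L\subset H$ is a linear subspace of codimension one in $H$, the connected components of $H\setminus L$ are the half-hyperplanes determined by $(H,L)$, and $L$ is their boundary. An $r$-fan in $\mathbb{R}^d$ is a collection $(L;F_1,\dots,F_r)$ where $L$ is a $(d-2)$-dimensional oriented linear subspace and $F_1,\dots,F_r$ are different half-hyperplanes with common boundary $L$, oriented by a compatible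 orientation on the plane $L^\perp$; that is, the points $F_1\cap S(L^\perp),\dots,F_r\cap S(L^\perp)$ are consecutive points on the unit circle $S(L^\perp)$ of $L^\perp$, oriented consistently with $L^\perp$. Its orthants are the open subsets $\mathcal{O}_1,\dots,\mathcal{O}_r$ of $S^{d-1}$, where $\mathcal{O}_i$ lies between the consecutive cuts $F_i\cap S^{d-1}$ and $F_{i+1}\cap S^{d-1}$ (with $F_{r+1}=F_1$). The fan is also written $(L,\mathcal{O}_1,\dots,\mathcal{O}_r)$. Arrangement in $k$-fan position: an arrangement $\{H_1,\dots,H_k\}$ of linear hyperplanes in $\mathbb{R}^d$ is in $k$-fan position if the intersection $H_1\cap\cdots\cap H_k$ is a subspace of codimension one inside each $H_i$; in other words, if there is a $2k$-fan $(L;F_1,\dots,F_{2k})$ such that $H_1\cap\cdots\cap H_k=L$ and $H_1\cup\cdots\cup H_k=L\cup F_1\cup\cdots\cup F_{2k}$. Its orthants $\mathcal{O}_1,\dots,\mathcal{O}_{2k}$ are the orthants of this $2k$-fan, in the cyclic order induced by the orientation of $L^\perp$; the labelling is determined up to a cyclic permutation. If $(H_1,\dots,H_k)$ is the induced ordering and $H_{k+1}=H_1$, then for $1\le i\le k$, $\mathcal{O}_i$ is the orthant between $H_i$ and $H_{i+1}$, and $\mathcal{O}_{k+i}$ is the opposite orthant, between $H_{i+1}$ and $H_i$. $\alpha$-partition: a $2k$-fan $(L,\mathcal{O}_1,\dots,\mathcal{O}_{2k})$, respectively an arrangement in $k$-fan position with orthants $\mathcal{O}_1,\dots,\mathcal{O}_{2k}$,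 is an $\alpha$-partition of $\mathcal{M}=\{\mu_1,\dots,\mu_j\}$ if there is $i\in\{1,\dots,j\}$ such that $\mu_i(\mathcal{O}_t)=\alpha_t$ for all $t\in\{1,\dots,2k\}$, and $\mu_l(\mathcal{O}_t)=\mu_l(\mathcal{O}_{k+t})$ for all $t\in\{1,\dots,k\}$ and all $l\in\{1,\dots,j\}$.
   Formalization: In (B) with k=1 no hyperplane has codimension one in itself, so (B) fails as written; there the condition that the intersection equals L is dropped: L is any codimension-one subspace of H_1 and the orthants are the two open hemispheres. Also j is taken to be at least 1. *)

(* Defs.v *)
From HB Require Import structures.
From mathcomp Require Import all_boot all_order all_algebra.
From mathcomp Require Import all_classical all_reals all_analysis.

Set Implicit Arguments.
Unset Strict Implicit.
Unset Printing Implicit Defensive.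

Import Order.TTheory GRing.Theory Num.Theory numFieldNormedType.Exports.

Local Open Scope classical_set_scope.
Local Open Scope ring_scope.

(* The norm that MathComp-Analysis puts on row vectors is the sup norm; the
   Euclidean structure is therefore taken from this inner product. *)
Definition dot (R : realType) (d : nat) (x y : 'rV[R]_d) : R :=
  \sum_(i < d) x ord0 i * y ord0 i.

(* S^n, the unit sphere of R^(n+1); the shift makes it nonempty, which
   measurable types require.  It carries the subspace topology. *)
Definition unit_sphere (R : realType) (n : nat) : set 'rV[R]_n.+1 :=
  [set x | dot x x = 1].

Definition sphere (R : realType) (n : nat) : Type := set_type (@unit_sphere R n).

Lemma unit_sphere_delta (R : realType) (n : nat) :
  (delta_mx ord0 ord0 : 'rV[R]_n.+1) \in @unit_sphere R n.
Proof.
rewrite inE /unit_sphere /= /dot (bigD1 ord0) //= big1 ?addr0.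
  by rewrite mxE !eqxx mulr1.
by move=> i /negPf i0; rewrite mxE i0 andbF mulr0.
Qed.

HB.instance Definition _ (R : realType) (n : nat) :=
  Topological.copy (sphere R n) (set_type (@unit_sphere R n)).
HB.instance Definition _ (R : realType) (n : nat) :=
  isPointed.Build (sphere R n) (SigSub (@unit_sphere_delta R n)).

Definition to_vec (R : realType) (n : nat) (x : sphere R n) : 'rV[R]_n.+1 :=
  set_val x.

Definition borel_sphere (R : realType) (n : nat) :=
  g_sigma_algebraType (@open (sphere R n)).

Definition proper_measure (R : realType) (n : nat)
    (mu : probability (borel_sphere R n) R) : Prop :=
  (forall H : {vspace 'rV[R]_n.+1}, (\dim H).+1 = n.+1 ->
     mu [set x : sphere R n | to_vec x \in H] = 0%E) /\
  (forall U : set (sphere R n), open U -> U !=set0 -> (0 < mu U)%E).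

(* A vector of Q^(2k) is indexed by 'I_(k + k): the coordinates i and k + i
   are lshift k i and rshift k i. *)
Definition ration (k : nat) (alpha : 'I_(k + k) -> rat) : Prop :=
  [/\ forall t : 'I_(k + k), 0 < alpha t,
      forall i : 'I_k, alpha (lshift k i) = alpha (rshift k i) &
      \sum_(i < k) alpha (lshift k i) = 2%:R^-1].

Definition half_hyperplane (R : realType) (d : nat)
    (L : {vspace 'rV[R]_d}) (F : set 'rV[R]_d) : Prop :=
  exists H : {vspace 'rV[R]_d},
    [/\ (\dim H).+1 = d, (L <= H)%VS, (\dim L).+1 = \dim H &
        exists2 x, ([set` H] `\` [set` L]) x
                 & F = connected_component ([set` H] `\` [set` L]) x].

Definition circ (R : realType) (d : nat) (u v : 'rV[R]_d) (theta : R) :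
    'rV[R]_d :=
  cos theta *: u + sin theta *: v.

(* An orientation of the axis L amounts to one of the plane L^perp; it is
   recorded by (fan_u, fan_v), a positively oriented orthonormal basis of
   L^perp.  The last field says that the points where the half-hyperplanes
   meet the unit circle of L^perp come in their cyclic order: their angles
   increase and span less than one full turn. *)
Record fan (R : realType) (d r : nat) := Fan {
  fan_axis : {vspace 'rV[R]_d};
  fan_u : 'rV[R]_d;
  fan_v : 'rV[R]_d;
  fan_half : 'I_r -> set 'rV[R]_d;
  fan_dim : (\dim fan_axis).+2 = d;
  fan_orthonormal :
    [/\ dot fan_u fan_u = 1, dot fan_v fan_v = 1 & dot fan_u fan_v = 0];
  fan_perp : forall x, x \in fan_axis -> dot x fan_u = 0 /\ dot x fan_v = 0;
  fan_halfP : forall i, half_hyperplane fan_axis (fan_half i);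
  fan_half_inj : injective fan_half;
  fan_cyclic : exists theta : 'I_r -> R,
    [/\ forall i, fan_half i (circ fan_u fan_v (theta i)),
        forall i j : 'I_r, (i < j)%N -> theta i < theta j &
        forall i j : 'I_r, theta j < theta i + 2 * pi] }.

(* Points of the sphere whose orthogonal projection to L^perp is nonzero, with
   an angle strictly between those of the half-hyperplanes i and i + 1
   (cyclically), going in the positive direction. *)
Definition orthant (R : realType) (n r : nat) (Phi : fan R n.+1 r) (i : 'I_r) :
    set (sphere R n) :=
  let c := circ (fan_u Phi) (fan_v Phi) in
  [set x | exists theta phi theta' : R,
    [/\ fan_half Phi i (c theta),
        fan_half Phi (ordS i) (c theta'),
        theta < phi < theta',
        theta' <= theta + 2 * pi &
        exists2 t : R, 0 < t & to_vec x - t *: c phi \in fan_axis Phi]].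

(* Phi exhibits the arrangement {H_1, ..., H_k} as being in k-fan position.
   For k = 1 the intersection of the arrangement is H_1 itself and cannot have
   codimension one in H_1; there L is any subspace of codimension one in H_1,
   and the orthants are the two open hemispheres bounded by H_1. *)
Definition fan_position_by (R : realType) (d k : nat)
    (H : 'I_k -> {vspace 'rV[R]_d}) (Phi : fan R d (k + k)) : Prop :=
  [/\ forall i, (\dim (H i)).+1 = d,
      injective H,
      (1 < k)%N -> (\bigcap_(i < k) H i)%VS = fan_axis Phi &
      \bigcup_(i in [set: 'I_k]) [set` H i] =
        [set` fan_axis Phi] `|` \bigcup_(t in [set: 'I_(k + k)]) fan_half Phi t].

Definition alpha_partition (R : realType) (n k j : nat)
    (alpha : 'I_(k + k) -> rat) (mu : 'I_j -> probability (borel_sphere R n) R)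
    (O : 'I_(k + k) -> set (sphere R n)) : Prop :=
  exists i : 'I_j,
    (forall t : 'I_(k + k), mu i (O t) = (ratr (alpha t))%:E) /\
    (forall (t : 'I_k) (l : 'I_j),
        mu l (O (lshift k t)) = mu l (O (rshift k t))).

(* The orthants of an arrangement are labelled up to a cyclic permutation (and
   the choice of an orientation of L^perp), that is, up to the choice of Phi. *)
Definition arrangement_alpha_partition (R : realType) (n k j : nat)
    (alpha : 'I_(k + k) -> rat) (mu : 'I_j -> probability (borel_sphere R n) R)
    (H : 'I_k -> {vspace 'rV[R]_n.+1}) : Prop :=
  exists Phi : fan R n.+1 (k + k),
    fan_position_by H Phi /\ alpha_partition alpha mu (orthant Phi).

(* Main.v *)
Require Import Defs.
From HB Require Import structures.
From mathcomp Require Import all_boot all_order all_algebra.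
From mathcomp Require Import all_classical all_reals all_analysis.
From mathcomp Require Import measurable_realfun zify ring lra.

(** Fix a measure lambda that is to be cut in the proportions alpha. An oriented plane
    with an orthonormal basis (u, v) determines a 2k-fan whose axis is orthogonal to it:
    projecting to the plane, take the arc bisected by u that carries half of lambda, and
    cut this arc, then its complement, in the proportions alpha_1, ..., alpha_k. Since
    lambda is proper the cuts are unique and depend continuously on (u, v)
    ([half_arc_exists], [half_fan_exists]). Starting from the bisector, and not from a
    side of the arc, is what makes the construction equivariant: the complementary arc
    is bisected by - u, so (- u, - v) gives the same fan with its labels shifted by k
    ([half_arcN]). For each further measure, the difference between the masses of two
    opposite orthants is therefore an odd continuous function of (u, v), and the problem
    is to find a common zero of these functions.

    The pairs (x, i x), with x in a sphere of a complex vector space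
    C^p = R^(2p) contained in R^(n+1), form an antipodally invariant sphere of dimension
    2p - 1 in the space of all (u, v). One can choose 2p >= n, so the classical
    Borsuk-Ulam theorem ([borsuk_ulam]) yields a common zero of any n - 1 odd functions;
    this is [balanced_angles]. With lambda the first of the measures, the k (j - 1)
    functions of the other measures give the first claim ([fan_partition]). For the
    second claim lambda is the average of the first measure and its image under the
    antipode, and the k j functions of all the measures are made to vanish. Since lambda
    is symmetric, F_(k+t) is opposite to F_t, so the fan comes from an arrangement; and
    the first measure, being balanced, has the same masses as lambda on the orthants
    ([arrangement_partition]).

    The Borsuk-Ulam theorem is derived from Tucker's lemma. The lemma is proved for
    chains of tuples of points modulo 2, with the parity argument of Ky Fan
    ([tower_complementary]), and applied to the iterated barycentric subdivisions of the
    boundary of the cross-polytope. The continuity of masses comes from dominated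
    convergence and from the fact that hyperplanes are null ([arc_mass_continuous]). *)

Set Implicit Arguments.
Unset Strict Implicit.
Unset Printing Implicit Defensive.
Import Order.TTheory GRing.Theory Num.Theory numFieldNormedType.Exports.

(** * Mod-2 chains of tuples *)

Section Chains.
Variable T : Type.
Implicit Types (s : seq T) (c : seq (seq T)).

(** A chain with coefficients in Z/2 is encoded as a list of simplices, a simplex
    being the list of its vertices. Only the parity of multiplicities matters;
    instead of a quotient, equality is tested through all cochains, that is, all
    predicates on simplices. *)
Definition parity (P : pred (seq T)) c := odd (count P c).

Definition chain_eq c c' := forall P, parity P c = parity P c'.

Definition bind_chain (U V : Type) (F : U -> seq V) (c : seq U) : seq V :=
  flatten (map F c).

(** The complex is augmented: the boundary of a vertex is the empty simplex. The
    cone formula below then has no exception in low dimension. *)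
Fixpoint boundary s : seq (seq T) :=
  if s is x :: s' then s' :: map (cons x) (boundary s') else [::].

Lemma parity_cat P c c' : parity P (c ++ c') = parity P c (+) parity P c'.
Proof. by rewrite /parity count_cat oddD. Qed.

Lemma parity_cons P s c : parity P (s :: c) = P s (+) parity P c.
Proof. by rewrite /parity /= oddD oddb. Qed.

Lemma parity_map (U : Type) P (h : U -> seq T) (c : seq U) :
  parity P (map h c) = odd (count (P \o h) c).
Proof. by rewrite /parity count_map. Qed.

(** The parity of [P] on an image chain is the parity of a predicate (the
    transposed cochain) on the original chain, so that linear extensions respect
    equality of chains. *)
Lemma parity_bind P (F : seq T -> seq (seq T)) c :
  parity P (bind_chain F c) = parity (fun s => parity P (F s)) c.
Proof.
elim: c => // s c IH; rewrite /bind_chain /= parity_cat parity_cons.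
by rewrite -/(bind_chain F c) IH.
Qed.

Lemma bind_chain_eq F c c' :
  chain_eq c c' -> chain_eq (bind_chain F c) (bind_chain F c').
Proof. by move=> h P; rewrite !parity_bind h. Qed.

(** The cone formula. Cycles bound their cones, which is why subdivisions and facets
    are built below by coning. *)
Lemma parity_boundary_cone P x c :
  parity P (bind_chain boundary (map (cons x) c)) =
  parity P c (+) parity (P \o cons x) (bind_chain boundary c).
Proof.
elim: c => // t c IHc; rewrite /= /bind_chain /=.
rewrite parity_cons !parity_cat -!/(bind_chain _ _) IHc parity_cons.
by rewrite parity_map -/(parity _ _) [in RHS]addbACA !addbA.
Qed.

Lemma boundary_boundary s : chain_eq (bind_chain boundary (boundary s)) [::].
Proof.
elim: s => // x s IH P /=; rewrite /bind_chain /= parity_cat -/(bind_chain _ _).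
by rewrite parity_boundary_cone (IH (P \o cons x)) addbF addbb.
Qed.

Lemma boundary_all (n : nat) (P : pred T) s : size s = n -> all P s ->
  all (fun t => (size t == n.-1) && all P t) (boundary s).
Proof.
elim: s n => [|x s IH] [|n] //= [sn] /andP[Px Ps].
rewrite sn eqxx Ps /= all_map; move: (IH n sn Ps).
case: n {IH} sn => [|n] sn; first by case: s sn {Ps}.
by apply: sub_all => t /andP[/eqP st Pt] /=; rewrite st eqxx Px.
Qed.

(** ** Barycentric subdivision *)

Variable center : seq T -> T.

(** The first argument is the number of vertices of the simplex; it makes the
    recursion structural. *)
Fixpoint subdiv n s : seq (seq T) :=
  if n is n'.+1
  then map (cons (center s)) (bind_chain (subdiv n') (boundary s))
  else [:: [::]].

(** Subdivision is a chain map: the subdivided simplex is a cone over the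
    subdivided boundary, which by induction is a cycle. *)
Lemma boundary_subdiv n s : size s = n.+1 ->
  chain_eq (bind_chain boundary (subdiv n.+1 s))
           (bind_chain (subdiv n) (boundary s)).
Proof.
elim: n s => [|n IH] s sn P.
  by case: s sn => // x [|//] _; rewrite /bind_chain /= !parity_cons /parity.
set C := bind_chain (subdiv n.+1) (boundary s).
rewrite [subdiv _ _]/= -/C parity_boundary_cone; set b := parity _ _.
suff -> : parity (P \o cons (center s)) (bind_chain boundary C) = false.
  by rewrite addbF.
set Q := P \o _.
have := boundary_all sn (all_predT s).
transitivity (parity Q
   (bind_chain (subdiv n) (bind_chain boundary (boundary s)))).
  rewrite /C !parity_bind.
  elim: (boundary s) H => // t c IHc /= /andP[/andP[/eqP st _] /IHc].
  rewrite !parity_cons => ->; congr (_ (+) _).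
  by rewrite -!parity_bind IH.
by rewrite parity_bind boundary_boundary.
Qed.

Lemma subdiv_size n s : all (fun t => size t == n) (subdiv n s).
Proof.
elim: n s => //= n IH s; rewrite all_map.
rewrite /bind_chain; elim: (boundary s) => //= t c IHc.
by rewrite all_cat IHc andbT; apply: sub_all (IH t) => r /= /eqP->.
Qed.

End Chains.

(** ** Antipodal towers *)

Section Towers.
Variables (T : eqType) (opp : T -> T).

(** The chains [c 0], [c 1], ... play the role of the upper hemispheres of the
    spheres [S^0], [S^1], ...: the boundary of a hemisphere is the sphere of one
    dimension less, the union of a hemisphere and its antipode. *)
Definition antipodal_tower (c : nat -> seq (seq T)) :=
  chain_eq (bind_chain (@boundary T) (c 0)) [:: [::]] /\
  forall i, chain_eq (bind_chain (@boundary T) (c i.+1))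
                     (c i ++ map (map opp) (c i)).

Lemma boundary_map (h : T -> T) s :
  boundary (map h s) = map (map h) (boundary s).
Proof. by elim: s => //= x s ->; rewrite -!map_comp. Qed.

Lemma bind_chain_map (U : Type) (g : U -> U) (F : U -> seq U) d :
  (forall t, F (g t) = map g (F t)) ->
  bind_chain F (map g d) = map g (bind_chain F d).
Proof.
by move=> Fg; rewrite /bind_chain; elim: d => //= t d ->; rewrite Fg map_cat.
Qed.

Lemma subdiv_map center n s :
  (forall s, center (map opp s) = opp (center s)) ->
  subdiv center n (map opp s) = map (map opp) (subdiv center n s).
Proof.
move=> centerN; elim: n s => //= n IH s.
rewrite boundary_map centerN.
rewrite (bind_chain_map _ IH) -!map_comp.
by apply: eq_map => t.
Qed.

(** Both the chain map property and the equivariance of subdivision are needed to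
    carry the relation between consecutive chains to the subdivided ones. *)
Lemma tower_subdiv center c :
  (forall s, center (map opp s) = opp (center s)) ->
  (forall i, all (fun s => size s == i.+1) (c i)) ->
  antipodal_tower c ->
  antipodal_tower (fun i => bind_chain (subdiv center i.+1) (c i)).
Proof.
move=> centerN sc [c0 cS].
have bdsub i : chain_eq
    (bind_chain (@boundary T) (bind_chain (subdiv center i.+1) (c i)))
    (bind_chain (subdiv center i) (bind_chain (@boundary T) (c i))).
  move=> P; rewrite !parity_bind.
  elim: (c i) (sc i) => // s d IHd /= /andP[/eqP ss /IHd].
  rewrite !parity_cons => ->; congr (_ (+) _).
  by rewrite -!parity_bind boundary_subdiv.
split=> [P|i P]; first by rewrite bdsub (bind_chain_eq _ c0).
rewrite bdsub (bind_chain_eq _ (cS i)) /bind_chain map_cat flatten_cat.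
rewrite !parity_cat; congr (_ (+) _).
rewrite -!/(bind_chain _ _) (@bind_chain_map _ (map opp)) // => s.
exact: subdiv_map.
Qed.

(** ** Tucker's lemma *)

Section Labels.
Variables (sign : T -> bool) (index : T -> nat).

Fixpoint insert_label x s :=
  if s is y :: s' then
    if index x <= index y then x :: s else y :: insert_label x s'
  else [:: x].

Definition sort_labels s := foldr insert_label [::] s.

Lemma all_insert_label (P : pred T) x s :
  all P (insert_label x s) = P x && all P s.
Proof.
elim: s => //= y s IH; case: ifP => // _ /=.
by rewrite IH andbCA.
Qed.

Lemma size_sort_labels s : size (sort_labels s) = size s.
Proof.
elim: s => //= x s <-; elim: (sort_labels s) => //= y t IH.
by case: ifP => //= _; rewrite IH.
Qed.

Lemma all_sort_labels (P : pred T) s : all P (sort_labels s) = all P s.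
Proof. by elim: s => //= x s IH; rewrite all_insert_label IH. Qed.

Definition le_label x y := index x <= index y.

Lemma le_label_trans : transitive le_label.
Proof. by move=> y x z; apply: leq_trans. Qed.

Lemma sorted_sort_labels s : sorted le_label (sort_labels s).
Proof.
elim: s => //= x s; elim: (sort_labels s) => //= y t IH.
case: (leqP (index x) (index y)) => [xy|yx] /=; first by rewrite /le_label xy.
rewrite !(path_sortedE le_label_trans) all_insert_label => /andP[yt st].
by rewrite IH // yt /le_label (ltnW yx).
Qed.

Lemma boundary_insert_label P x s : sorted le_label s ->
  parity P (boundary (insert_label x s)) =
  parity P (s :: map (insert_label x) (boundary s)).
Proof.
elim: s P => //= y s IH P ys.
have ss := path_sorted ys.
case: (leqP (index x) (index y)) => [xy|yx] /=.
  rewrite !parity_cons; congr (_ (+) (_ (+) _)).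
    by case: s {IH ss} ys => //= z s /andP[yz _]; rewrite (leq_trans xy yz).
  rewrite -!map_comp; congr (parity _ _).
  by apply: eq_map => t /=; rewrite xy.
rewrite !parity_cons parity_map -/(parity _ _) IH // parity_cons /=.
rewrite [in RHS]addbCA; congr (_ (+) (_ (+) _)).
rewrite -!map_comp !parity_map.
by congr (odd _); apply: eq_count => t /=; rewrite leqNgt yx.
Qed.

(** Sorting commutes with the boundary, so that the alternation of the sorted signs
    is a cochain to which the coboundary formula [alternating_boundary] applies. *)
Lemma boundary_sort_labels P s :
  parity P (boundary (sort_labels s)) = parity P (map sort_labels (boundary s)).
Proof.
elim: s P => //= x s IH P.
rewrite boundary_insert_label ?sorted_sort_labels // !parity_cons.
congr (_ (+) _).
rewrite -map_comp [in RHS]parity_map parity_map -/(parity _ _) IH.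
by rewrite parity_map.
Qed.

Fixpoint alternating b s :=
  if s is x :: s' then (sign x == b) && alternating (~~ b) s' else true.

(** If the signs alternate, removing an inner vertex makes two equal signs adjacent,
    while removing an end leaves an alternating sequence, and exactly one of the
    two ends gives the prescribed first sign. If they do not alternate, the faces
    that alternate come in pairs: they remove one of two adjacent equal signs. *)
Lemma alternating_boundary b s :
  parity (alternating b) (boundary s) = alternating true s (+) alternating false s.
Proof.
elim: s b => //= x s IH b.
rewrite parity_cons parity_map.
have -> : count (alternating b \o cons x) (boundary s) =
  if sign x == b then count (alternating (~~ b)) (boundary s) else 0.
  case: eqP => xb; last first.
    by rewrite -(count_pred0 (boundary s)); apply: eq_count => t /=; case: eqP.
  by apply: eq_count => t /=; rewrite xb eqxx.
case: (sign x) b => [] [] //=; rewrite -?/(parity _ _) ?IH ?addbF //=.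
- by rewrite addbA addbb.
- by rewrite [alternating true s (+) _]addbC addbA addbb.
Qed.

Definition sorted_alternating b s := alternating b (sort_labels s).

Lemma parity_sorted_alternating c :
  parity (sorted_alternating true) (bind_chain (@boundary T) c) =
  parity (sorted_alternating true) c (+) parity (sorted_alternating false) c.
Proof.
rewrite parity_bind; elim: c => // s c IHc.
rewrite !parity_cons IHc [RHS]addbACA; congr (_ (+) _).
rewrite /sorted_alternating -(alternating_boundary true) boundary_sort_labels.
by rewrite parity_map.
Qed.

Variable D : pred T.
Hypothesis signN : forall x, D x -> sign (opp x) = ~~ sign x.
Hypothesis indexN : forall x, D x -> index (opp x) = index x.

Lemma sorted_alternating_opp b s : all D s ->
  sorted_alternating b (map opp s) = sorted_alternating (~~ b) s.
Proof.
move=> Ds; rewrite /sorted_alternating.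
have -> : sort_labels (map opp s) = map opp (sort_labels s).
  elim: s Ds => //= x s IH /andP[Dx Ds]; rewrite IH //.
  have : all D (sort_labels s) by rewrite all_sort_labels.
  elim: (sort_labels s) => //= y t IHt /andP[Dy Dt].
  by rewrite !indexN //; case: ifP => //= _; rewrite IHt.
have : all D (sort_labels s) by rewrite all_sort_labels.
elim: (sort_labels s) b => //= x t IH b /andP[Dx Dt].
by rewrite IH // signN // -(inj_eq negb_inj) negbK.
Qed.

(** Ky Fan's count. The antipode exchanges the two kinds of alternating simplices,
    so the coboundary formula shows that the parity of their total number is the
    same in all the chains of the tower. It is odd in the lowest one, whose boundary
    is the empty simplex. *)
Lemma tower_alternating c i : antipodal_tower c ->
  (forall j, j < i -> all (all D) (c j)) ->
  parity (sorted_alternating true) (c i) (+)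
  parity (sorted_alternating false) (c i).
Proof.
move=> [c0 cS]; elim: i => [|i IH] Dc.
  by rewrite -parity_sorted_alternating c0.
rewrite -parity_sorted_alternating cS parity_cat.
have -> : parity (sorted_alternating true) (map (map opp) (c i)) =
          parity (sorted_alternating false) (c i).
  2: by apply: IH => j /ltnW/Dc.
rewrite parity_map /parity.
elim: (c i) (Dc i (ltnSn i)) => //= s d IHd /andP[Ds /IHd].
by rewrite !oddD => ->; rewrite (sorted_alternating_opp true).
Qed.

(** Two vertices with the same index are consecutive once sorted, hence of opposite
    signs if the simplex alternates; without such a pair the indices increase
    strictly, which bounds the number of vertices. *)
Lemma alternating_complementary b x s :
  path le_label x s -> alternating b (x :: s) ->
  (exists y z, [/\ y \in x :: s, z \in x :: s, index y = index z &
                   sign z = ~~ sign y]) \/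
  index x + size s <= index (last x s).
Proof.
elim: s b x => [|y s IH] b x /=; first by rewrite addn0; right.
move=> /andP[xy ys] /andP[/eqP sx] alts.
have [exy|nxy] := eqVneq (index x) (index y).
  left; exists x, y; rewrite !inE !eqxx !orbT; split=> //.
  by case/andP: alts => /eqP->; rewrite sx.
case: (IH _ _ ys alts) => [[u [v [us vs]]]|le].
  by left; exists u, v; rewrite [u \in _]in_cons [v \in _]in_cons us vs !orbT.
right; apply: leq_trans le; rewrite addnS -addSn leq_add2r.
by rewrite ltn_neqAle nxy.
Qed.

(** Tucker's lemma, for labels of absolute value [index] and sign [sign]. The domain
    [D] leaves room for points where an odd labelling is impossible, such as the
    fixed points of the antipode. *)
Lemma tower_complementary c i m : antipodal_tower c ->
  (forall j, j <= i -> all (all D) (c j)) ->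
  (forall x, D x -> index x < m) ->
  all (fun s => size s == i.+1) (c i) -> m <= i ->
  exists s x y, [/\ s \in c i, x \in s, y \in s, index x = index y &
                    sign y = ~~ sign x].
Proof.
move=> tc Dc ltm sc mi.
have [b] : exists b, has (sorted_alternating b) (c i).
  have := tower_alternating tc (fun j ji => Dc j (ltnW ji)); rewrite /parity.
  have [->|h _] := posnP (count (sorted_alternating true) (c i)); last first.
    by exists true; rewrite has_count.
  have [->//|h _] := posnP (count (sorted_alternating false) (c i)).
  by exists false; rewrite has_count.
case/hasP => s sci alts; exists s.
have mem_sort : sort_labels s =i s.
  move=> x; rewrite -!has_pred1; apply: negb_inj.
  by rewrite -!all_predC all_sort_labels.
have := size_sort_labels s; rewrite (eqP (allP sc _ sci)).
case E : (sort_labels s) => [//|x t] /= [szt].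
move: alts (sorted_sort_labels s); rewrite /sorted_alternating E.
move=> alts /alternating_complementary/(_ alts)[[y [z]]|le].
  by rewrite -E !mem_sort => -[ys zs yz sz]; exists y, z.
have lasts : last x t \in s by rewrite -mem_sort E mem_last.
have := ltm _ (allP (allP (Dc i (leqnn i)) _ sci) _ lasts).
by rewrite ltnNge (leq_trans mi) // -szt (leq_trans _ le) // leq_addl.
Qed.

End Labels.
End Towers.

Local Open Scope classical_set_scope.
Local Open Scope ring_scope.

(** * The Euclidean inner product *)

Section Dot.
Variables (R : realType) (d : nat).
Implicit Types x y z : 'rV[R]_d.

Lemma dotC x y : dot x y = dot y x.
Proof. by apply: eq_bigr => i _; rewrite mulrC. Qed.

Lemma dotDr x y z : dot x (y + z) = dot x y + dot x z.
Proof. by rewrite -big_split; apply: eq_bigr => i _; rewrite mxE mulrDr. Qed.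

Lemma dotZr a x y : dot x (a *: y) = a * dot x y.
Proof. by rewrite mulr_sumr; apply: eq_bigr => i _; rewrite mxE mulrCA. Qed.

Lemma dotDl x y z : dot (x + y) z = dot x z + dot y z.
Proof. by rewrite dotC dotDr !(dotC z). Qed.

Lemma dotZl a x y : dot (a *: x) y = a * dot x y.
Proof. by rewrite dotC dotZr dotC. Qed.

Lemma dotNr x y : dot x (- y) = - dot x y.
Proof. by rewrite -scaleN1r dotZr mulN1r. Qed.

Lemma dotNl x y : dot (- x) y = - dot x y.
Proof. by rewrite dotC dotNr dotC. Qed.

Lemma dot_mxE x y : dot x y = (x *m y^T) ord0 ord0.
Proof. by rewrite mxE; apply: eq_bigr => i _; rewrite mxE. Qed.

Lemma dot_ge0 x : 0 <= dot x x.
Proof. by apply: sumr_ge0 => i _; rewrite -expr2 sqr_ge0. Qed.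

Lemma dot_eq0 x : (dot x x == 0) = (x == 0).
Proof.
apply/eqP/eqP => [/psumr_eq0P x0|->]; last first.
  by rewrite /dot big1 // => i _; rewrite mxE mul0r.
apply/rowP => i; rewrite mxE.
have /x0/(_ i isT)/eqP : forall j, true -> 0 <= x ord0 j * x ord0 j.
  by move=> j _; rewrite -expr2 sqr_ge0.
by rewrite mulf_eq0 orbb => /eqP.
Qed.

End Dot.

(** * The Borsuk-Ulam theorem *)

Section CrossTower.
Variables (R : realType) (M : nat).
Notation V := 'rV[R]_M.
Implicit Types (s t : seq V).

Definition barycenter s : V := (size s)%:R^-1 *: \sum_(x <- s) x.

Definition axis (i : nat) : V := \row_j ((j : nat) == i)%:R.

(** These simplices triangulate the boundary of the cross-polytope whose vertices are
    the vectors [axis j] and [- axis j] for [j < i], a sphere of dimension [i - 1]. *)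
Fixpoint cross_facets (i : nat) : seq (seq V) :=
  if i is i'.+1
  then map (cons (axis i')) (cross_facets i') ++
       map (cons (- axis i')) (cross_facets i')
  else [:: [::]].

Definition hemisphere i := map (cons (axis i)) (cross_facets i).

Lemma boundary_cross_facets i :
  chain_eq (bind_chain (@boundary V) (cross_facets i)) [::].
Proof.
elim: i => [|i IH] P //=.
rewrite /bind_chain map_cat flatten_cat parity_cat -!/(bind_chain _ _).
rewrite !parity_boundary_cone !(IH (P \o _)) /parity /=.
by rewrite !addbF addbb.
Qed.

Lemma boundary_hemisphere i :
  chain_eq (bind_chain (@boundary V) (hemisphere i)) (cross_facets i).
Proof.
by move=> P; rewrite parity_boundary_cone (boundary_cross_facets _ (P \o _)) addbF.
Qed.

Lemma cross_facets_opp i :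
  chain_eq (map (map -%R) (cross_facets i)) (cross_facets i).
Proof.
elim: i => [|i IH] P //=; rewrite map_cat !parity_cat addbC.
have mapc x : parity P (map (map -%R) (map (cons x) (cross_facets i))) =
    parity P (map (cons (- x)) (cross_facets i)).
  rewrite [RHS]parity_map -/(parity _ _) -IH !parity_map count_map.
  by congr (odd _); apply: eq_count.
by rewrite !mapc opprK.
Qed.

Lemma hemisphere_tower : antipodal_tower -%R hemisphere.
Proof.
split=> [|i] P; first by rewrite boundary_hemisphere.
rewrite boundary_hemisphere !parity_cat; congr (_ (+) _).
rewrite [LHS]parity_map -/(parity _ _) -(cross_facets_opp i) /hemisphere.
by rewrite !parity_map count_map; congr (odd _); apply: eq_count.
Qed.

Lemma size_hemisphere i : all (fun s => size s == i.+1) (hemisphere i).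
Proof.
rewrite all_map; elim: i => //= i IH; rewrite all_cat !all_map.
by apply/andP; split; apply: sub_all IH => s /= /eqP[->].
Qed.

Lemma barycenterN s : barycenter (map -%R s) = - barycenter s.
Proof. by rewrite /barycenter size_map big_map sumrN scalerN. Qed.

(** ** The mesh of iterated subdivisions *)

(** Stability under barycentres is all that is needed of convexity to pass from the
    vertices of a simplex to those of its subdivision. *)
Definition convex_pred (P : V -> Prop) :=
  forall s, s != [::] -> {in s, forall x, P x} -> P (barycenter s).

Lemma sum_seq_le (F : V -> R) s (a : R) : {in s, forall x, F x <= a} ->
  \sum_(x <- s) F x <= (size s)%:R * a.
Proof.
elim: s => [|x s IH] h; first by rewrite big_nil mul0r.
rewrite big_cons /= -natr1 mulrDl mul1r addrC lerD ?h ?mem_head //.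
by apply: IH => y ys; rewrite h // in_cons ys orbT.
Qed.

Lemma barycenter_sub s x : s != [::] ->
  x - barycenter s = (size s)%:R^-1 *: \sum_(y <- s) (x - y).
Proof.
move=> s0; rewrite /barycenter sumrB scalerBr; congr (_ - _).
rewrite big_const_seq count_predT iter_addr_0 -[x *+ _]scaler_nat scalerA.
by rewrite mulVf ?scale1r // pnatr_eq0 size_eq0.
Qed.

Lemma barycenter_dist s x a : s != [::] ->
  (\sum_(y <- s) `|x - y|) <= (size s)%:R * a -> `|x - barycenter s| <= a.
Proof.
move=> s0 h; have sp : 0 < (size s)%:R :> R by rewrite ltr0n lt0n size_eq0.
rewrite barycenter_sub // normrZ ger0_norm ?invr_ge0 ?ler0n //.
rewrite ler_pdivrMl //; apply: le_trans h; exact: ler_norm_sum.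
Qed.

Lemma convex_ball x a : convex_pred (fun y => `|x - y| <= a).
Proof.
by move=> s s0 h; apply: barycenter_dist => //; apply: sum_seq_le.
Qed.

Lemma convex_hyperplane (v : V) : convex_pred (fun y => dot y v = 1).
Proof.
move=> s s0 h; have : dot (\sum_(x <- s) x) v = (size s)%:R.
  elim: s h {s0} => [|x s IH] h.
    by rewrite big_nil /dot big1 // => i _; rewrite mxE mul0r.
  rewrite big_cons /= -natr1 -IH => [|y ys]; last by rewrite h // in_cons ys orbT.
  rewrite -(h x) ?mem_head // addrC /dot -big_split /=.
  by apply: eq_bigr => i _; rewrite mxE mulrDl.
rewrite /barycenter /dot => E.
under eq_bigr do rewrite mxE -mulrA.
by rewrite -mulr_sumr E mulVf // pnatr_eq0 size_eq0.
Qed.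

Lemma convex_and P Q :
  convex_pred P -> convex_pred Q -> convex_pred (fun x => P x /\ Q x).
Proof.
by move=> cP cQ s s0 h; split; [apply: cP|apply: cQ] => // x /h [].
Qed.

Lemma boundary_sub s t : t \in boundary s ->
  {subset t <= s} /\ size t = (size s).-1.
Proof.
move=> ts; have h : all (mem s) s by apply/allP.
have /allP/(_ _ ts)/andP[/eqP-> /allP] := boundary_all (erefl (size s)) h.
by [].
Qed.

Lemma subdiv_cons n s r : r \in subdiv barycenter n.+1 s ->
  exists t r', [/\ r = barycenter s :: r', t \in boundary s &
                   r' \in subdiv barycenter n t].
Proof.
move=> /mapP[r' /flattenP[c /mapP[t ts ->] r'c] ->].
by exists t, r'.
Qed.

Lemma subdiv_convex P n s r : convex_pred P -> size s = n ->
  {in s, forall x, P x} -> r \in subdiv barycenter n s ->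
  {in r, forall x, P x}.
Proof.
move=> cP; elim: n s r => [|n IH] s r sn Ps; first by rewrite inE => /eqP->.
move=> /subdiv_cons[t [r' [-> ts r't]]] x; rewrite in_cons => /predU1P[->|].
  by apply: cP => //; case: s sn {Ps ts}.
have [sub st] := boundary_sub ts.
apply: IH r't x; first by rewrite st sn.
by move=> x /sub/Ps.
Qed.

Definition mesh_le (D : R) s := {in s &, forall x y, `|x - y| <= D}.

(** The barycentre of a simplex with [n] vertices is at distance at most [(n - 1) / n]
    times the diameter from each vertex, because the vertex itself contributes
    nothing to the mean distance; the bound extends to all points by convexity of
    balls. A bound [N.+1] on the number of vertices makes the rate uniform. *)
Lemma subdiv_mesh N n s r D : size s = n -> (n <= N.+1)%N -> 0 <= D ->
  mesh_le D s -> r \in subdiv barycenter n s -> mesh_le (N%:R / N.+1%:R * D) r.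
Proof.
elim: n s r => [|n IH] s r sn nN D0 Ds; first by rewrite inE => /eqP->.
move=> rs; have [t [r' [E ts r't]]] := subdiv_cons rs.
have [sub st] := boundary_sub ts.
have s0 : s != [::] by case: s sn {Ds rs ts E sub st}.
have near x : x \in r -> `|barycenter s - x| <= N%:R / N.+1%:R * D.
  apply: (@subdiv_convex (fun y => _) n.+1 s r) x => //; first exact: convex_ball.
  move=> x xs; rewrite distrC; apply: barycenter_dist => //.
  rewrite (perm_big _ (perm_to_rem xs)) big_cons /= subrr normr0 add0r.
  apply: (@le_trans _ _ (n%:R * D)).
    have -> : n = size (rem x s) by rewrite size_rem // sn.
    by apply: sum_seq_le => y /mem_rem ys; apply: Ds.
  rewrite mulrA ler_wpM2r // sn mulrA ler_pdivlMr ?ltr0n //.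
  by rewrite -!natrM ler_nat mulnC mulSn mulSn mulnC leq_add2r.
have D'0 : 0 <= N%:R / N.+1%:R * D by rewrite mulr_ge0 // divr_ge0.
move=> x y; rewrite E in near *; rewrite !in_cons => /predU1P[->|xr] /predU1P[->|yr].
- by rewrite subrr normr0.
- by apply: near; rewrite in_cons yr orbT.
- by rewrite distrC; apply: near; rewrite in_cons xr orbT.
- apply: (IH t r') => //; first by rewrite st sn.
    exact: ltnW.
  by move=> u v /sub us /sub vs; apply: Ds.
Qed.

(** A facet lies in the hyperplane [dot x v = 1], where [v] is its vector of signs.
    This convex condition is inherited by its subdivisions and keeps them away
    from 0. The vanishing of the coordinates from [i] on is what the induction on
    [i] uses. *)
Lemma cross_facet_normal i s : (i <= M)%N -> s \in cross_facets i ->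
  exists v : V, [/\ forall j, `|v ord0 j| <= 1,
    forall j : 'I_M, (i <= j)%N -> v ord0 j = 0 &
    {in s, forall x, [/\ dot x v = 1, `|x| <= 1 &
                         forall j : 'I_M, (i <= j)%N -> x ord0 j = 0]}].
Proof.
elim: i s => [|i IH] s iM.
  rewrite inE => /eqP->; exists 0; split=> // j; last by rewrite mxE.
  by rewrite mxE normr0.
have dot_axis (x : V) : dot x (axis i) = x ord0 (Ordinal iM).
  rewrite /dot (bigD1 (Ordinal iM)) //= mxE eqxx mulr1 big1 ?addr0 // => j ji.
  by rewrite mxE -(inj_eq val_inj) in ji *; rewrite (negPf ji) mulr0.
have : s \in cross_facets i.+1 -> exists (b : bool) t,
    t \in cross_facets i /\ s = (-1) ^+ b *: axis i :: t.
  rewrite mem_cat => /orP[] /mapP[t ti ->].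
  - by exists false, t; rewrite scale1r.
  - by exists true, t; rewrite scaleN1r.
move=> /[apply] -[b [t [/(IH _ (ltnW iM))[v [v1 v0 tv]] ->]]].
have axisE (j : 'I_M) : (((-1) ^+ b *: axis i : V) ord0 j) =
    if (j : nat) == i then (-1) ^+ b else 0.
  by rewrite !mxE; case: eqP; rewrite ?mulr1 ?mulr0.
have ax0 (j : 'I_M) : (i < j)%N -> ((-1) ^+ b *: axis i : V) ord0 j = 0.
  by rewrite axisE ltn_neqAle eq_sym => /andP[/negPf->].
exists (v + (-1) ^+ b *: axis i); split=> [j|j ij|x].
- rewrite mxE axisE; case: eqP => [ji|_]; last by rewrite addr0.
  by rewrite v0 ?ji // add0r normr_sign.
- by rewrite mxE ax0 // addr0 v0 // ltnW.
rewrite in_cons dotDr dotZr dot_axis => /predU1P[->|/tv[xv x1 x0]]; last first.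
  by split=> // [|j /ltnW/x0//]; rewrite xv x0 ?mulr0 ?addr0.
split=> //.
- rewrite dotZl dotC dot_axis v0 //= mulr0 add0r axisE eqxx -expr2.
  by rewrite sqrr_sign.
- rewrite normrZ normr_sign mul1r [leLHS]mx_normrE.
  apply/bigmax_leP; split=> // -[k j] _ /=; rewrite mxE.
  by case: eqP; rewrite ?normr1 ?normr0.
Qed.

Lemma dot_norm_le (x v : V) : (forall j, `|v ord0 j| <= 1) ->
  dot x v <= M%:R * `|x|.
Proof.
move=> v1; rewrite -[X in X%:R]card_ord -sum1_card natr_sum mulr_suml.
apply: ler_sum => j _; rewrite mul1r (le_trans (ler_norm _)) // normrM.
by rewrite -[leRHS]mulr1 ler_pM // [leRHS]mx_normrE; apply: le_bigmax (ord0, j).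
Qed.

Definition fine_hemisphere r :=
  iter r (fun c i => bind_chain (subdiv barycenter i.+1) (c i)) hemisphere.

Lemma fine_hemisphereP r : antipodal_tower -%R (fine_hemisphere r) /\
  forall i, all (fun s => size s == i.+1) (fine_hemisphere r i).
Proof.
elim: r => [|r [tw sz]].
  by split; [exact: hemisphere_tower|exact: size_hemisphere].
split=> /=; first by apply: tower_subdiv => //; exact: barycenterN.
move=> i; apply/allP => s /flattenP[c /mapP[t ti ->] st].
exact: (allP (subdiv_size barycenter i.+1 t) _ st).
Qed.

Lemma fine_hemisphere_face r i s : (i < M)%N -> s \in fine_hemisphere r i ->
  exists v : V, (forall j, `|v ord0 j| <= 1) /\
    {in s, forall x, dot x v = 1 /\ `|0 - x| <= 1}.
Proof.
move=> iM; elim: r s => [|r IH] s /=.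
  move=> sc; have : s \in cross_facets i.+1 by rewrite mem_cat sc.
  move=> /(cross_facet_normal iM)[v [v1 _ sv]]; exists v; split=> // x /sv[].
  by rewrite sub0r normrN.
move=> /flattenP[c /mapP[t ti ->] st]; have [v [v1 vt]] := IH _ ti.
exists v; split=> // x.
have [_ /(_ i) /allP/(_ _ ti)/eqP szt] := fine_hemisphereP r.
apply: (@subdiv_convex (fun x => dot x v = 1 /\ `|0 - x| <= 1) i.+1 t s
  _ _ _ st) => //.
by apply: convex_and; [exact: convex_hyperplane|exact: convex_ball].
Qed.

Lemma fine_hemisphere_mesh N r i s : (i < M)%N -> (i <= N)%N ->
  s \in fine_hemisphere r i -> mesh_le ((N%:R / N.+1%:R) ^+ r * 2) s.
Proof.
move=> iM iN; elim: r s => [|r IH] s.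
  move=> /(fine_hemisphere_face iM)[v [_ sv]] x y /sv[_ x1] /sv[_ y1].
  move: x1 y1; rewrite expr0 mul1r !sub0r !normrN => x1 y1.
  by rewrite (le_trans (ler_normB _ _)) // -[2]/(1 + 1) lerD.
move=> /flattenP[c /mapP[t ti ->] st].
have [_ /(_ i) /allP/(_ _ ti)/eqP szt] := fine_hemisphereP r.
rewrite exprS -mulrA; apply: (subdiv_mesh szt) st => //; last exact: IH.
Qed.

End CrossTower.

Section BorsukUlam.
Variables (R : realType) (M : nat) (I : finType) (f : I -> 'rV[R]_M -> R).
Hypothesis IM : (#|I| < M)%N.
Hypothesis fcont : forall i x, x != 0 -> {for x, continuous (f i)}.
Hypothesis fodd : forall i x, f i (- x) = - f i x.

(** Each point is labelled by the coordinate of [f] of largest absolute value,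
    with its sign; a complementary edge of the [r]-th subdivision joins two
    close points at which this coordinate has opposite signs. *)
Lemma complementary_edge r : (forall x, x != 0 -> exists i, f i x != 0) ->
  exists x y i,
  [/\ M%:R^-1 <= `|x| <= 1, `|x - y| <= (M%:R / M.+1%:R) ^+ r * 2,
      forall j, `|f j x| <= `|f i x|, forall j, `|f j y| <= `|f i y| &
      f i x * f i y <= 0].
Proof.
move=> fN0; case: (pickP (mem I)) => [i0 _|I0]; last first.
  have x0 : (const_mx 1 : 'rV[R]_M) != 0.
    apply/eqP => /rowP/(_ (Ordinal (leq_ltn_trans (leq0n _) IM))).
    by rewrite !mxE => /eqP; rewrite oner_eq0.
  by have [i _] := fN0 _ x0; have := I0 i.
pose argmax (g : I -> R) := [arg max_(i > i0) g i]%O.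
pose lab x := argmax (fun i => `|f i x|).
have labP x j : `|f j x| <= `|f (lab x) x|.
  by rewrite /lab /argmax; case: arg_maxP => //= i _ /(_ j)->.
have labN x : lab (- x) = lab x.
  by congr argmax; apply/funext => i; rewrite fodd normrN.
have lab0 x : x != 0 -> f (lab x) x != 0.
  move=> /fN0[i fi]; apply: contra fi => /eqP fl.
  by rewrite -normr_eq0 eq_le normr_ge0 andbT -(normr0 R) -fl labP.
pose sg x := 0 < f (lab x) x; pose ix x := (enum_rank (lab x) : nat).
have M0 : (0 < M)%N := leq_ltn_trans (leq0n _) IM.
have M1 : (M.-1 < M)%N by rewrite ltn_predL.
have [tw szt] := fine_hemisphereP R M r.
have face i : (i < M)%N -> forall s, s \in fine_hemisphere R M r i ->
    {in s, forall x, M%:R^-1 <= `|x| <= 1}.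
  move=> iM s /(fine_hemisphere_face iM)[v [v1 sv]] x /sv[xv].
  rewrite sub0r normrN => ->; rewrite andbT -[leLHS]mulr1 ler_pdivrMl ?ltr0n //.
  by rewrite -[leLHS]xv; exact: dot_norm_le.
have non0 (x : 'rV[R]_M) : M%:R^-1 <= `|x| -> x != 0.
  by move=> h; rewrite -normr_gt0 (lt_le_trans _ h) // invr_gt0 ltr0n.
have [||||||s [x [y [sc xs ys exy sxy]]]] :=
  @tower_complementary _ _ sg ix (fun x => x != 0) _ _ _ M.-1 #|I| tw.
- move=> x x0; rewrite /sg labN fodd oppr_gt0 -leNgt le_eqVlt.
  by rewrite (negPf (lab0 _ x0)).
- by move=> x _; rewrite /ix labN.
- move=> j jM; apply/allP => s sj; apply/allP => x xs; apply: non0.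
  by have /andP[] := face j (leq_ltn_trans jM M1) s sj x xs.
- by move=> x _; apply: ltn_ord.
- exact: szt.
- by rewrite -ltnS prednK.
have lxy : lab x = lab y by apply: enum_rank_inj; apply: val_inj.
exists x, y, (lab x); split.
- exact: face M1 _ sc _ xs.
- by apply: (fine_hemisphere_mesh M1 _ sc) => //; exact: leq_pred.
- exact: labP.
- by rewrite lxy; exact: labP.
move: sxy; rewrite /sg -lxy; case: (ltrP 0 (f _ x)) => fx /=.
- by move=> /negbT; rewrite -leNgt => fy; rewrite mulr_ge0_le0 // ltW.
- by move=> fy; rewrite mulr_le0_ge0 // ltW.
Qed.

(** The complementary edges of finer and finer subdivisions accumulate at some point
    of the annulus, and the largest coordinate of [f], which changes sign along
    them, must vanish there. *)
Theorem borsuk_ulam : exists2 x : 'rV[R]_M, x != 0 & forall i, f i x = 0.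
Proof.
apply: contrapT => nex.
have fN0 x : x != 0 -> exists i, f i x != 0.
  move=> x0; apply: contrapT => fx; apply: nex; exists x => // i.
  by apply: contrapT => /eqP fi; apply: fx; exists i.
have M0 : (0 < M)%N := leq_ltn_trans (leq0n _) IM.
have /choice[xs] := fun r => complementary_edge r fN0.
move=> /choice[ys] /choice[cs] edge.
pose K := [set x : 'rV[R]_M | M%:R^-1 <= `|x| <= 1].
have cK : compact K.
  apply: bounded_closed_compact.
    by exists 1; split=> [|B /ltW B1 x /andP[_ x1]]; last exact: le_trans B1.
  rewrite (_ : K = (fun x => `|x|) @^-1` `[M%:R^-1, 1]).
    by apply: closed_comp => [x _|]; [exact: norm_continuous|exact: itv_closed].
  by apply/seteqP; split=> x /=; rewrite in_itv.
have [p [Kp clp]] : K `&` cluster (xs @ \oo) !=set0.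
  by apply: cK; exists 0%N => // r _; case: (edge r).
have p0 : p != 0.
  rewrite -normr_gt0 (@lt_le_trans _ _ M%:R^-1) //.
    by rewrite invr_gt0 ltr0n.
  by case/andP: Kp.
have [i1 fi1] := fN0 _ p0.
pose eta := `|f i1 p|; have eta0 : 0 < eta by rewrite normr_gt0.
have : \forall z \near p, forall i, `|f i p - f i z| < eta / 3.
  apply: (@filter_forall _ I (fun i z => `|f i p - f i z| < eta / 3) (nbhs p) _).
  move=> i; have /cvgrPdist_lt := @fcont i p p0; apply.
  by rewrite divr_gt0.
move=> /nbhs_ballP[rho /= rho0 near_p].
have q1 : `|M%:R / M.+1%:R : R| < 1.
  by rewrite ger0_norm ?divr_ge0 // ltr_pdivrMr ?ltr0n // mul1r ltr_nat.
have [r0 _ small] : \forall r \near \oo, (M%:R / M.+1%:R) ^+ r * 2 < rho / 2 :> R.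
  have : (M%:R / M.+1%:R) ^+ r * 2 @[r --> \oo] --> (0 * 2 : R).
    by apply: cvgM; [exact: cvg_expr|exact: cvg_cst].
  rewrite mul0r => /cvgrPdist_lt/(_ (rho / 2)) []; first by rewrite divr_gt0.
  move=> r0 _ h; exists r0 => // r /h; rewrite /= sub0r normrN.
  exact: le_lt_trans (ler_norm _).
have [z [[r /= r0r <-] pz]] :
    (xs @` [set r | (r0 <= r)%N]) `&` ball p (rho / 2) !=set0.
  apply: clp; last by apply: nbhsx_ballx; rewrite divr_gt0.
  by exists r0 => // r r0r; exists r.
have [_ xy fx fy sxy] := edge r.
have /near_p fxp : ball p rho (xs r) by apply: le_ball pz; lra.
have /near_p fyp : ball p rho (ys r).
  move: pz; rewrite -!ball_normE /= => pz.
  rewrite -(subrKA (xs r)) (le_lt_trans (ler_normD _ _)) //.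
  rewrite [ltRHS](splitr rho) ltrD // (le_lt_trans xy) //; exact: small.
have [a b] := (fxp (cs r), fyp (cs r)).
have [c d] := (fxp i1, fyp i1).
have [e g] := (fx i1, fy i1).
(* Both end points keep more than 2/3 of eta in their largest coordinate, with
   opposite signs, while the variation of each coordinate is less than 2/3 of eta. *)
have big w : `|f i1 p - f i1 w| < eta / 3 -> eta * 2 / 3 < `|f i1 w|.
  by have := ler_normD (f i1 p - f i1 w) (f i1 w); rewrite subrK -/eta; lra.
have hx := lt_le_trans (big _ c) e; have hy := lt_le_trans (big _ d) g.
set X := f (cs r) (xs r) in a hx sxy *; set Y := f (cs r) (ys r) in b hy sxy *.
set P := f (cs r) p in a b *; clear - a b hx hy sxy eta0.
move: a b hx hy sxy; rewrite !ltr_norml => /andP[a1 a2] /andP[b1 b2].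
case: (ger0P X) => X0; case: (ger0P Y) => Y0 hx hy sxy; [|lra|lra|].
- have : 0 < X * Y by rewrite mulr_gt0 //; lra.
  lra.
- by move: sxy; rewrite leNgt nmulr_rgt0 ?Y0.
Qed.

End BorsukUlam.

(** * Open sectors of the plane *)

Section Sectors.
Variable R : realType.
Implicit Types th ph psi t a b : R.

Definition polar psi t a b := [/\ 0 < t, a = t * cos psi & b = t * sin psi].

Definition sector th ph a b := exists psi t, th < psi < ph /\ polar psi t a b.

(** The signed distance of (a, b) to the line of angle th, positive to the left. *)
Definition cross th a b := b * cos th - a * sin th.

Lemma cross_polar th psi t a b :
  polar psi t a b -> cross th a b = t * sin (psi - th).
Proof. by case=> _ -> ->; rewrite /cross sinB; ring. Qed.

Lemma cos2x (x : R) : cos x = 1 - 2 * sin (x / 2) ^+ 2.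
Proof. by rewrite {1}(splitr x) cosD -!expr2 cos2sin2; ring. Qed.

Lemma cos_lt1 (x : R) : 0 < x < 2 * pi -> cos x < 1.
Proof.
move=> /andP[x0 x2]; rewrite cos2x.
have : 0 < sin (x / 2) by apply: sin_gt0_pi; lra.
by move=> s0; rewrite gtrBl mulr_gt0 // exprn_gt0.
Qed.

Lemma polar2pi psi t a b : polar (psi + 2 * pi) t a b <-> polar psi t a b.
Proof. by rewrite /polar mulr_natl cosD2pi sinD2pi. Qed.

Lemma polarDpi psi t a b : polar (psi + pi) t a b <-> polar psi t (- a) (- b).
Proof.
rewrite /polar cosDpi sinDpi !mulrN; split=> -[-> ea eb]; split=> //; lra.
Qed.

Lemma sector2pi th ph a b :
  sector (th + 2 * pi) (ph + 2 * pi) a b <-> sector th ph a b.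
Proof.
split=> -[psi [t [/andP[h1 h2] p]]].
- exists (psi - 2 * pi), t; split; first by apply/andP; split; lra.
  by apply/polar2pi; rewrite subrK.
- exists (psi + 2 * pi), t; split; first by apply/andP; split; lra.
  exact/polar2pi.
Qed.

Lemma sectorDpi th ph a b :
  sector (th + pi) (ph + pi) a b <-> sector th ph (- a) (- b).
Proof.
split=> -[psi [t [/andP[h1 h2] p]]].
- exists (psi - pi), t; split; first by apply/andP; split; lra.
  by apply/polarDpi; rewrite subrK.
- exists (psi + pi), t; split; first by apply/andP; split; lra.
  exact/polarDpi.
Qed.

Lemma sectorZ c th ph a b : 0 < c -> sector th ph (c * a) (c * b) <-> sector th ph a b.
Proof.
move=> c0; split=> -[psi [t [h [t0 ea eb]]]].
- exists psi, (t / c); split=> //; split; first by rewrite divr_gt0.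
    by apply: (mulfI (lt0r_neq0 c0)); rewrite ea mulrA mulrCA divff ?mulr1 ?gt_eqF.
  by apply: (mulfI (lt0r_neq0 c0)); rewrite eb mulrA mulrCA divff ?mulr1 ?gt_eqF.
- exists psi, (c * t); split=> //; split; first by rewrite mulr_gt0.
    by rewrite ea mulrA.
  by rewrite eb mulrA.
Qed.

Lemma sector_mono th ph th' ph' a b : th' <= th -> ph <= ph' ->
  sector th ph a b -> sector th' ph' a b.
Proof.
move=> h1 h2 [psi [t [/andP[h3 h4] p]]]; exists psi, t; split=> //.
by apply/andP; split; lra.
Qed.

Lemma sector_lt th ph a b : sector th ph a b -> th < ph.
Proof. by move=> [psi [t [/andP[h3 h4] _]]]; exact: lt_trans h4. Qed.

(** Each radius is the other one times the cosine of the difference of the angles,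
    which is less than 1 unless the angles agree. *)
Lemma polar_angle_eq psi psi' t t' a b : polar psi t a b -> polar psi' t' a b ->
  0 <= psi' - psi < 2 * pi -> psi = psi'.
Proof.
move=> [t0 ea eb] [t0' ea' eb'] /andP[d0 d2].
have [-> //|dn] := eqVneq psi psi'.
have c1 : cos (psi' - psi) < 1.
  by apply: cos_lt1; rewrite d2 andbT lt_neqAle d0 eq_sym subr_eq0 eq_sym dn.
have e1 : t' * cos (psi' - psi) = t.
  rewrite cosB mulrDr !mulrA -ea' -eb' ea eb -!mulrA -mulrDr -!expr2.
  by rewrite cos2Dsin2 mulr1.
have e2 : t * cos (psi' - psi) = t'.
  rewrite cosB mulrDr ![t * (_ * _)]mulrCA -ea -eb ea' eb' !(mulrCA _ t') -mulrDr.
  by rewrite -!expr2 cos2Dsin2 mulr1.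
have : t * cos (psi' - psi) < t by rewrite gtr_pMr.
have : t' * cos (psi' - psi) < t' by rewrite gtr_pMr.
lra.
Qed.

Lemma sector_disj th ph ch a b : ch <= th + 2 * pi ->
  sector th ph a b -> sector ph ch a b -> False.
Proof.
move=> c2 [psi [t [/andP[h1 h2] p]]] [psi' [t' [/andP[h1' h2'] p']]].
have : psi = psi' by apply: polar_angle_eq p p' _; apply/andP; split; lra.
lra.
Qed.

Lemma polar_exists0 a b : (a, b) != (0, 0) ->
  exists psi t, 0 <= psi < 2 * pi /\ polar psi t a b.
Proof.
move=> ab0; pose t := Num.sqrt (a ^+ 2 + b ^+ 2).
have n0 : 0 < a ^+ 2 + b ^+ 2.
  rewrite lt_neqAle addr_ge0 ?sqr_ge0 // andbT eq_sym; apply: contra ab0.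
  by rewrite paddr_eq0 ?sqr_ge0 // !sqrf_eq0 xpair_eqE.
have t0 : 0 < t by rewrite sqrtr_gt0.
have t2 : t ^+ 2 = a ^+ 2 + b ^+ 2 by rewrite sqr_sqrtr // ltW.
have c1 : -1 <= a / t <= 1.
  rewrite -ler_norml normrM normfV (gtr0_norm t0) ler_pdivrMr // mul1r.
  by rewrite -sqrtr_sqr ler_wsqrtr // lerDl sqr_ge0.
have sn : t * sin (acos (a / t)) = `|b|.
  rewrite sin_acos // -{1}(gtr0_norm t0) -sqrtr_sqr -sqrtrM ?sqr_ge0 //.
  rewrite mulrBr mulr1 -exprMn mulrCA divff ?gt_eqF // mulr1 t2.
  by rewrite addrC addKr sqrtr_sqr.
have cs : t * cos (acos (a / t)) = a.
  by rewrite acosK ?in_itv //= mulrCA divff ?mulr1 ?gt_eqF.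
have p0 := pi_gt0 R.
have [b0|b0] := lerP 0 b.
  exists (acos (a / t)), t; split; last by split; rewrite // sn ger0_norm.
  by rewrite acos_ge0 //= (le_lt_trans (acos_lepi c1)) //; lra.
exists (2 * pi - acos (a / t)), t; split.
  have := acos_lepi c1; rewrite ltrBlDr ltrDl acos_gt0 ?andbT; first lra.
  rewrite (andP c1).1 ltr_pdivrMr // mul1r.
  apply: contraTT b0; rewrite -!leNgt => ta.
  have : t ^+ 2 <= a ^+ 2 by rewrite ler_pXn2r ?nnegrE ?(ltW t0) // (le_trans _ ta) // ltW.
  rewrite t2 gerDl => b2; have : b ^+ 2 == 0 by rewrite eq_le b2 sqr_ge0.
  by rewrite sqrf_eq0 => /eqP->.
rewrite -[2 * pi - _]addrC; apply/polar2pi; split=> //; first by rewrite cosN.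
by rewrite sinN mulrN sn ltr0_norm // opprK.
Qed.

Lemma polar_exists th a b : (a, b) != (0, 0) ->
  exists psi t, th <= psi < th + 2 * pi /\ polar psi t a b.
Proof.
move=> ab0; pose a' := a * cos th + b * sin th; pose b' := b * cos th - a * sin th.
have sc := cos2Dsin2 th.
have ea : a = a' * cos th - b' * sin th.
  by rewrite -[LHS]mulr1 -sc /a' /b'; ring.
have eb : b = a' * sin th + b' * cos th.
  by rewrite -[LHS]mulr1 -sc /a' /b'; ring.
have /polar_exists0[psi [t [/andP[h1 h2] [t0 pa pb]]]] : (a', b') != (0, 0).
  apply: contra ab0; rewrite !xpair_eqE => /andP[/eqP a0 /eqP b0].
  by rewrite ea eb a0 b0 !mul0r subrr addr0 eqxx.
exists (th + psi), t; split; first by apply/andP; split; lra.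
by split; rewrite // 1?ea 1?eb pa pb ?cosD ?sinD; ring.
Qed.

Lemma cross_angle psi t a b : polar psi t a b -> cross psi a b = 0.
Proof. by move=> /(cross_polar psi)->; rewrite subrr sin0 mulr0. Qed.

Lemma sector_cover th ph a b : ph <= th + 2 * pi ->
  cross th a b != 0 -> cross ph a b != 0 ->
  sector th ph a b \/ sector ph (th + 2 * pi) a b.
Proof.
move=> h ct cp; have ab0 : (a, b) != (0, 0).
  by apply: contra ct => /eqP[-> ->]; rewrite /cross !mul0r subrr.
have [psi [t [/andP[h1 h2] p]]] := polar_exists th ab0.
have np : psi != ph by apply: contraNneq cp => <-; rewrite (cross_angle p).
have nt : psi != th by apply: contraNneq ct => <-; rewrite (cross_angle p).
have [ltp|gtp|/eqP] := ltgtP psi ph; last by rewrite (negPf np).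
- by left; exists psi, t; split=> //; rewrite ltp andbT lt_neqAle eq_sym nt.
- by right; exists psi, t; rewrite gtp.
Qed.

Lemma sector_split th ph ch a b : sector th ch a b -> cross ph a b != 0 ->
  sector th ph a b \/ sector ph ch a b.
Proof.
move=> [psi [t [/andP[h1 h2] p]]] cp.
have np : psi != ph by apply: contraNneq cp => <-; rewrite (cross_angle p).
have [ltp|gtp|/eqP] := ltgtP psi ph; last by rewrite (negPf np).
- by left; exists psi, t; rewrite h1 ltp.
- by right; exists psi, t; rewrite h2 gtp.
Qed.

Lemma sector_of_cross th ph a b : th <= ph <= th + pi ->
  0 < cross th a b -> cross ph a b < 0 -> sector th ph a b.
Proof.
move=> /andP[h h'] ct cp; have ab0 : (a, b) != (0, 0).
  by apply: contraTN ct => /eqP[-> ->]; rewrite /cross !mul0r subrr ltxx.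
have [psi [t [/andP[h1 h2] p]]] := polar_exists th ab0.
have t0 : 0 < t by case: p.
move: ct cp; rewrite !(cross_polar _ p) pmulr_rgt0 // pmulr_rlt0 // => st sp.
have p0 := pi_gt0 R.
exists psi, t; split=> //; apply/andP; split.
  by rewrite lt_neqAle h1 andbT; apply/eqP => e; move: st; rewrite -e subrr sin0 ltxx.
rewrite ltNge; apply/negP => phpsi.
have [psipi|psipi] := lerP psi (th + pi).
  have : 0 <= sin (psi - ph).
    by apply: sin_ge0_pi; apply/andP; split; lra.
  by rewrite leNgt sp.
have : 0 < sin (psi - th - pi) by apply: sin_gt0_pi; apply/andP; split; lra.
have := sinDpi (psi - th - pi); rewrite subrK.
lra.
Qed.

(** A sector may be wider than a half plane, and then it is not an intersection of half
    planes. Shrunk around one of its points it becomes one, and the resulting strict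
    linear inequalities persist when the point and the sides move slightly. *)
Lemma sector_open th ph a b : sector th ph a b -> exists th1 ph1,
  [/\ th < th1, ph1 < ph, th1 <= ph1 <= th1 + pi, 0 < cross th1 a b & cross ph1 a b < 0].
Proof.
move=> [psi [t [/andP[h1 h2] p]]].
pose d := Num.min (Num.min (psi - th) (ph - psi)) 1 / 2.
have d0 : 0 < d by rewrite divr_gt0 // !lt_min; apply/andP; split=> //; lra.
have p2 := pi_ge2 R.
have [d1 d2 d3] : [/\ d <= (psi - th) / 2, d <= (ph - psi) / 2 & d <= 1 / 2].
  by split; rewrite ler_pM2r ?invr_gt0 // !ge_min lexx ?orbT.
have sd : 0 < sin d by apply: sin_gt0_pi; apply/andP; split; lra.
have t0 : 0 < t by case: p.
exists (psi - d), (psi + d); split; [lra|lra|apply/andP; split; lra| |].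
- by rewrite (cross_polar _ p) opprB addrC subrK mulr_gt0.
- by rewrite (cross_polar _ p) opprD addrA subrr add0r sinN mulrN oppr_lt0 mulr_gt0.
Qed.

End Sectors.

(** * Sets varying continuously up to null sets *)

Section MeasureContinuity.
Context {d : measure_display} {T : measurableType d} {R : realType}.
Variable mu : probability T R.

Definition mass (A : set T) : R := fine (mu A).

Lemma massK A : measurable A -> (mass A)%:E = mu A.
Proof. by move=> mA; rewrite fineK // fin_num_measure. Qed.

Lemma mass_eq (N A B : set T) : measurable N -> mu N = 0%E ->
  measurable A -> measurable B -> (forall y, ~ N y -> A y <-> B y) ->
  mass A = mass B.
Proof.
move=> mN N0 mA mB AB; congr fine.
rewrite -(measureU0 mA mN N0) -(measureU0 mB mN N0); congr (mu _).
apply/seteqP; split=> y [h|]; try by right.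
  by have [Ny|/AB[/(_ h)]] := pselect (N y); [right|left].
by have [Ny|/AB[_ /(_ h)]] := pselect (N y); [right|left].
Qed.

Lemma massU A B : measurable A -> measurable B -> A `&` B = set0 ->
  mass (A `|` B) = mass A + mass B.
Proof.
move=> mA mB AB; apply: EFin_inj; rewrite EFinD !massK //; last exact: measurableU.
exact: measureU.
Qed.

(** Dominated convergence of the indicator functions. *)
Lemma mass_sequence (A_ : nat -> set T) (A N : set T) :
  (forall k, measurable (A_ k)) -> measurable A -> measurable N -> mu N = 0%E ->
  (forall y, ~ N y -> \forall k \near \oo, A_ k y <-> A y) ->
  mass (A_ k) @[k --> \oo] --> mass A.
Proof.
move=> mA_ mA mN N0 lim; apply: fine_cvg; rewrite massK //.
have mEFin (B : set T) : measurable B ->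
    measurable_fun [set: T] (fun x => (\1_B x : R)%:E).
  by move=> mB; apply: (measurable_EFinP setT (\1_B : T -> R)).2; exact: measurable_indic.
have [|||||_ _] := @dominated_convergence _ _ _ mu setT measurableT
  (fun k x => (\1_(A_ k) x)%:E) (fun x => (\1_A x)%:E) (cst 1%E).
- by move=> k; exact: mEFin.
- exact: mEFin.
- exists N; split=> // y /= h; apply: contrapT => /lim[k0 _ Ak]; apply: h => _.
  apply: cvg_near_cst; exists k0 => // k /Ak E; rewrite !indicE.
  by have -> : (y \in A_ k) = (y \in A) by apply/idP/idP; rewrite !inE => /E.
- exact: finite_measure_integrable_cst.
- by apply: aeW => y k _; rewrite lee_fin indicE; case: (_ \in _); rewrite ?normr1 ?normr0.
rewrite integral_indic // setIT; apply: cvg_trans.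
by apply: near_eq_cvg; near=> k; rewrite /= integral_indic // setIT.
Unshelve. all: by end_near.
Qed.

Lemma mass_continuous (X : pseudoMetricType R) (A : X -> set T) (w0 : X) N :
  (forall w, measurable (A w)) -> measurable N -> mu N = 0%E ->
  (forall y, ~ N y -> \forall w \near w0, A w y <-> A w0 y) ->
  {for w0, continuous (fun w => mass (A w))}.
Proof.
move=> mA mN N0 lim; apply/cvgrPdist_lt => e e0.
apply: contrapT => far.
have /choice[ws wsP] : forall k : nat, exists w, ball w0 k.+1%:R^-1 w /\
    e <= `|mass (A w0) - mass (A w)|.
  move=> k; apply: contrapT => nex; apply: far.
  apply/nbhs_ballP; exists k.+1%:R^-1 => /= [|w bw]; first by rewrite invr_gt0.
  by rewrite ltNge; apply/negP => ew; apply: nex; exists w.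
have /cvgrPdist_lt/(_ e e0)[k0 _ /(_ k0 (leqnn _))] :
    mass (A (ws k)) @[k --> \oo] --> mass (A w0).
  apply: (@mass_sequence _ _ N) => // y /lim/nbhs_ballP[r /= r0 br].
  have [k1 _ kr] : \forall k \near \oo, (k.+1%:R^-1 : R) < r.
    exact: near_infty_natSinv_lt (PosNum r0).
  exists k1 => // k /kr/= kr'; apply: br; apply: le_ball (wsP k).1; exact: ltW.
by rewrite ltNge (wsP k0).2.
Qed.

End MeasureContinuity.

(** * Hyperplanes and kernels *)

Section Kernels.
Variables (R : realType) (d q : nat).

Definition null_space (A : 'M[R]_(d, q)) : {vspace 'rV[R]_d} :=
  lker (linfun (mulmxr A : 'rV[R]_d -> 'rV[R]_q)).

Lemma mem_null_space A x : (x \in null_space A) = (x *m A == 0).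
Proof. by rewrite memv_ker lfunE. Qed.

Lemma dim_null_space A (B : 'M[R]_(q, d)) : B *m A = 1%:M ->
  (\dim (null_space A) + q)%N = d.
Proof.
move=> BA; pose f := linfun (mulmxr A : 'rV[R]_d -> 'rV[R]_q).
have := limg_ker_dim f fullv.
rewrite capfv dimvf /dim /= mul1n => E; apply: etrans E; congr (_ + _)%N.
have -> : (f @: fullv)%VS = fullv.
  apply/vspaceP => y; rewrite memvf; apply/memv_imgP.
  by exists (y *m B); rewrite ?memvf // lfunE /= -mulmxA BA mulmx1.
by rewrite dimvf /dim /= mul1n.
Qed.

End Kernels.

Section NormalHyperplane.
Variables (R : realType) (d : nat).

Definition hyperplane (a : 'rV[R]_d) : {vspace 'rV[R]_d} := null_space a^T.

Lemma mem_hyperplane a x : (x \in hyperplane a) = (dot x a == 0).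
Proof.
rewrite mem_null_space dot_mxE; apply/eqP/eqP => [->|h]; first by rewrite mxE.
by apply/matrixP => i j; rewrite !ord1 h mxE.
Qed.

Lemma dim_hyperplane a : a != 0 -> (\dim (hyperplane a)).+1 = d.
Proof.
move=> a0; rewrite -addn1; apply: (@dim_null_space _ _ _ _ ((dot a a)^-1 *: a)).
apply/matrixP => i j; rewrite !ord1 -scalemxAl mxE -dot_mxE mxE eqxx mulVf //.
by rewrite dot_eq0.
Qed.

End NormalHyperplane.

(** * Arcs of the sphere *)

Section Arcs.
Variables (R : realType) (n : nat).
Implicit Types (u v : 'rV[R]_n.+1) (th ph : R) (y : sphere R n).

Lemma to_vec_continuous : continuous (@to_vec R n).
Proof. exact: initial_continuous. Qed.

Lemma for_continuous_cst (X Y : topologicalType) (c : Y) (x0 : X) :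
  {for x0, continuous (fun=> c)}.
Proof. exact: cst_continuous. Qed.

Lemma dot_continuous (d : nat) (X : topologicalType) (f g : X -> 'rV[R]_d) x0 :
  {for x0, continuous f} -> {for x0, continuous g} ->
  {for x0, continuous (fun x => dot (f x) (g x))}.
Proof.
move=> cf cg.
suff h : dot (f x) (g x) @[x --> x0] --> dot (f x0) (g x0) by exact: h.
rewrite /dot; elim: (index_enum _) => [|i r IH].
  by rewrite big_nil; under eq_cvg do rewrite big_nil; exact: cvg_cst.
rewrite big_cons; under eq_cvg do rewrite big_cons.
apply: cvgD => //; apply: cvgM.
- exact: (cvg_comp _ (fun y : 'rV[R]_d => y ord0 i) cf (@coord_continuous _ _ _ _ _ (f x0))).
- exact: (cvg_comp _ (fun y : 'rV[R]_d => y ord0 i) cg (@coord_continuous _ _ _ _ _ (g x0))).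
Qed.

(** The two inner products are the coordinates of the projection to the plane of u
    and v, up to a common factor that sectors ignore, provided that (u, v) is a frame:
    u and v need not be normalised. *)
Definition sphere_arc u v th ph : set (sphere R n) :=
  [set y | sector th ph (dot (to_vec y) u) (dot (to_vec y) v)].

Definition frame u v := [/\ u != 0, dot u v = 0 & dot u u = dot v v].

Definition cut_normal u v th := cos th *: v - sin th *: u.

Lemma cut_normalE u v th (x : 'rV[R]_n.+1) :
  dot x (cut_normal u v th) = cross th (dot x u) (dot x v).
Proof. by rewrite /cross dotDr dotNr !dotZr mulrC [sin _ * _]mulrC. Qed.

Lemma cut_normal_neq0 u v th : frame u v -> cut_normal u v th != 0.
Proof.
move=> [u0 uv uu]; rewrite -dot_eq0 /cut_normal.
rewrite !(dotDl, dotDr, dotNl, dotNr, dotZl, dotZr) (dotC v u) uv -uu.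
set c := (X in X != 0); have -> : c = (cos th ^+ 2 + sin th ^+ 2) * dot u u.
  by rewrite /c; ring.
by rewrite cos2Dsin2 mul1r dot_eq0.
Qed.

Lemma sector_near (X : topologicalType) (x0 : X) (th ph a b : X -> R) :
  {for x0, continuous th} -> {for x0, continuous ph} ->
  {for x0, continuous a} -> {for x0, continuous b} ->
  sector (th x0) (ph x0) (a x0) (b x0) ->
  \forall x \near x0, sector (th x) (ph x) (a x) (b x).
Proof.
move=> cth cph ca cb /sector_open[th1 [ph1 [h1 h2 h3 h4 h5]]].
have ccross t : {for x0, continuous (fun x => cross t (a x) (b x))}.
  by apply: cvgB; apply: cvgM => //; exact: cvg_cst.
have n1 : \forall x \near x0, th x < th1 by exact: cvgr_lt cth _ h1.
have n2 : \forall x \near x0, ph1 < ph x by exact: cvgr_gt cph _ h2.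
have n3 : \forall x \near x0, 0 < cross th1 (a x) (b x).
  by exact: cvgr_gt (ccross th1) _ h4.
have n4 : \forall x \near x0, cross ph1 (a x) (b x) < 0.
  by exact: cvgr_lt (ccross ph1) _ h5.
near=> x.
have l1 : th x < th1 by near: x.
have l2 : ph1 < ph x by near: x.
apply: (sector_mono (ltW l1) (ltW l2)).
by apply: sector_of_cross => //; near: x.
Unshelve. all: by end_near.
Qed.

Lemma arc_open u v th ph : open (sphere_arc u v th ph).
Proof.
rewrite openE => y ay; apply: (@sector_near _ y (fun=> th) (fun=> ph)
  (fun y => dot (to_vec y) u) (fun y => dot (to_vec y) v)) ay.
- exact: for_continuous_cst.
- exact: for_continuous_cst.
- by apply: dot_continuous; [exact: to_vec_continuous|exact: for_continuous_cst].
- by apply: dot_continuous; [exact: to_vec_continuous|exact: for_continuous_cst].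
Qed.

Definition cut u v th : set (sphere R n) :=
  [set y | to_vec y \in hyperplane (cut_normal u v th)].

Lemma not_cut u v th y : ~ cut u v th y ->
  cross th (dot (to_vec y) u) (dot (to_vec y) v) != 0.
Proof. by rewrite /cut /= mem_hyperplane cut_normalE => /negP. Qed.

Lemma arc_measurable u v th ph :
  measurable (sphere_arc u v th ph : set (borel_sphere R n)).
Proof. by apply: sub_sigma_algebra; exact: arc_open. Qed.

Lemma cut_measurable u v th : measurable (cut u v th : set (borel_sphere R n)).
Proof.
rewrite -[cut _ _ _]setCK; apply: measurableC; apply: sub_sigma_algebra.
apply: closed_openC.
rewrite (_ : cut u v th = (fun y => dot (to_vec y) (cut_normal u v th)) @^-1` [set 0]).
  apply: closed_comp => [y _|]; last exact: closed_eq.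
  by apply: dot_continuous; [exact: to_vec_continuous|exact: for_continuous_cst].
by apply/seteqP; split=> y /=; rewrite /cut /= mem_hyperplane => /eqP.
Qed.

Lemma arc_nonempty u v th ph : frame u v -> th < ph -> sphere_arc u v th ph !=set0.
Proof.
move=> [u0 uv uu] thph; pose psi := (th + ph) / 2.
pose c := cos psi *: u + sin psi *: v.
have uu0 : 0 < dot u u by rewrite lt_neqAle dot_ge0 eq_sym dot_eq0 u0.
have cc : dot c c = dot u u.
  rewrite -[RHS]mul1r -(cos2Dsin2 psi).
  by rewrite !(dotDl, dotDr, dotZl, dotZr) (dotC v u) uv -uu; ring.
have r0 : 0 < Num.sqrt (dot u u) by rewrite sqrtr_gt0.
pose x := (Num.sqrt (dot u u))^-1 *: c.
have xS : x \in @unit_sphere R n.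
  rewrite inE /unit_sphere /= dotZl dotZr cc mulrA -invfM -expr2 sqr_sqrtr ?ltW //.
  by rewrite mulVf // gt_eqF.
exists (SigSub xS); exists psi, (dot u u / Num.sqrt (dot u u)).
rewrite /to_vec /=; split; first by apply/andP; rewrite /psi; split; lra.
rewrite !(dotZl, dotDl) (dotC v u) uv -uu.
split; first by rewrite divr_gt0.
- by ring.
- by ring.
Qed.

End Arcs.

Section ArcMass.
Variables (R : realType) (n : nat) (mu : probability (borel_sphere R n) R).
Hypothesis proper_mu : proper_measure mu.
Implicit Types (u v : 'rV[R]_n.+1) (th ph : R).

Definition arc_mass u v th ph := mass mu (sphere_arc u v th ph).

Lemma cut_null u v th : frame u v -> mu (cut u v th) = 0%E.
Proof.
by move=> fr; apply: proper_mu.1; rewrite dim_hyperplane // cut_normal_neq0.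
Qed.

(** Arcs are nonempty and open, and proper measures charge open sets. *)
Lemma arc_mass_gt0 u v th ph : frame u v -> th < ph -> 0 < arc_mass u v th ph.
Proof.
move=> fr thph; rewrite -lte_fin massK; last exact: arc_measurable.
by apply: proper_mu.2; [exact: arc_open|exact: arc_nonempty].
Qed.

Lemma arc_mass_ge0 u v th ph : 0 <= arc_mass u v th ph.
Proof. by rewrite -lee_fin massK //; exact: arc_measurable. Qed.

Lemma arc_mass_empty u v th ph : ph <= th -> arc_mass u v th ph = 0.
Proof.
move=> h; rewrite /arc_mass (_ : sphere_arc _ _ _ _ = set0) ?/mass ?measure0 //.
by apply/seteqP; split=> // y /sector_lt; rewrite ltNge h.
Qed.

Lemma arc_mass_split u v th ph ch : frame u v ->
  th <= ph -> ph <= ch -> ch <= th + 2 * pi ->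
  arc_mass u v th ch = arc_mass u v th ph + arc_mass u v ph ch.
Proof.
move=> fr h1 h2 h3; rewrite /arc_mass -massU; try exact: arc_measurable.
- apply: (mass_eq (cut_measurable u v ph) (cut_null ph fr)).
  + exact: arc_measurable.
  + by apply: measurableU; exact: arc_measurable.
  move=> y /not_cut cy; split=> [/sector_split/(_ cy)[]|[]]; [by left|by right| |].
  + exact: sector_mono.
  + exact: sector_mono.
- by apply/seteqP; split=> // y [/(sector_disj h3)].
Qed.

Lemma arc_mass_turn u v th : frame u v -> arc_mass u v th (th + 2 * pi) = 1.
Proof.
move=> fr; rewrite -[RHS]/(fine 1%E) -(@probability_setT _ _ _ mu).
apply: (mass_eq (cut_measurable u v th) (cut_null th fr)).
- exact: arc_measurable.
- exact: measurableT.
move=> y /not_cut cy; split=> // _.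
have cy' : cross (th + 2 * pi) (dot (to_vec y) u) (dot (to_vec y) v) != 0.
  by rewrite /cross mulr_natl cosD2pi sinD2pi.
by have [|//|/sector_lt] := sector_cover _ cy cy'; rewrite ?ltxx.
Qed.

Lemma arc_mass2pi u v th ph :
  arc_mass u v (th + 2 * pi) (ph + 2 * pi) = arc_mass u v th ph.
Proof. by congr mass; apply/seteqP; split=> y /sector2pi. Qed.

Lemma arc_massN u v th ph :
  arc_mass (- u) (- v) th ph = arc_mass u v (th + pi) (ph + pi).
Proof.
congr mass; apply/seteqP; split=> y; rewrite /sphere_arc /= !dotNr.
  by move/sectorDpi.
by move=> h; apply/sectorDpi.
Qed.

Lemma arc_massZ c u v th ph : 0 < c ->
  arc_mass (c *: u) (c *: v) th ph = arc_mass u v th ph.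
Proof.
move=> c0; congr mass; apply/seteqP; split=> y; rewrite /sphere_arc /= !dotZr.
  by move/(sectorZ _ _ _ _ c0).
by move=> h; apply/(sectorZ _ _ _ _ c0).
Qed.

Lemma arc_mass_lt u v th ph ph' : frame u v ->
  th <= ph -> ph < ph' -> ph' <= th + 2 * pi ->
  arc_mass u v th ph < arc_mass u v th ph'.
Proof.
move=> fr h1 h2 h3; rewrite (arc_mass_split fr h1 (ltW h2) h3) ltrDl.
exact: arc_mass_gt0.
Qed.

Lemma arc_mass_inj u v th ph ph' : frame u v ->
  th <= ph <= th + 2 * pi -> th <= ph' <= th + 2 * pi ->
  arc_mass u v th ph = arc_mass u v th ph' -> ph = ph'.
Proof.
move=> fr /andP[h1 h2] /andP[h1' h2'] e; have [lt|lt|//] := ltgtP ph ph'.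
- by have := arc_mass_lt fr h1 lt h2'; rewrite e ltxx.
- by have := arc_mass_lt fr h1' lt h2; rewrite e ltxx.
Qed.

(** The points of the two boundary cuts form a null set; any other point lies
    either in the arc or in the complementary one, and stays there when the
    parameters move. *)
Lemma arc_mass_continuous (X : pseudoMetricType R) (x0 : X)
    (u v : X -> 'rV[R]_n.+1) (th ph : X -> R) :
  (forall z, {for x0, continuous (fun x => dot z (u x))}) ->
  (forall z, {for x0, continuous (fun x => dot z (v x))}) ->
  {for x0, continuous th} -> {for x0, continuous ph} ->
  frame (u x0) (v x0) -> th x0 <= ph x0 -> ph x0 <= th x0 + 2 * pi ->
  {for x0, continuous (fun x => arc_mass (u x) (v x) (th x) (ph x))}.
Proof.
move=> cu cv cth cph fr h1 h2.
pose N := cut (u x0) (v x0) (th x0) `|` cut (u x0) (v x0) (ph x0).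
apply: (@mass_continuous _ _ _ mu X (fun x => sphere_arc (u x) (v x) (th x) (ph x)) x0 N).
- by move=> x; exact: arc_measurable.
- by apply: measurableU; exact: cut_measurable.
- rewrite measureU0; [exact: cut_null|exact: cut_measurable|exact: cut_measurable|].
  exact: cut_null.
move=> y Ny.
have /not_cut c1 : ~ cut (u x0) (v x0) (th x0) y by move=> h; apply: Ny; left.
have /not_cut c2 : ~ cut (u x0) (v x0) (ph x0) y by move=> h; apply: Ny; right.
have [s|s] := sector_cover h2 c1 c2.
  apply: filterS (sector_near cth cph (cu _) (cv _) s) => x sx.
  by split.
have cth' : {for x0, continuous (fun x => th x + 2 * pi)}.
  by apply: cvgD => //; exact: cvg_cst.
apply: filterS (sector_near cph cth' (cu _) (cv _) s) => x sx.
by split=> /sector_disj sy; [have := sy _ (lexx _) sx|have := sy _ (lexx _) s].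
Qed.

End ArcMass.

(** * Continuous families of angles *)

(** Since [g w] is increasing, continuity in [w] at each fixed value of the second
    variable is enough for the root to depend continuously on [w]: the values of
    [g w] at two points on either side of the root keep their position with
    respect to [c]. *)
Lemma implicit_root (R : realType) (X : topologicalType) (D : set X) (b c : R)
    (g : X -> R -> R) : open D -> 0 < b ->
  (forall w, D w -> g w 0 <= c <= g w b) ->
  (forall w s t, D w -> 0 <= s -> s < t -> t <= b -> g w s < g w t) ->
  (forall w s, D w -> 0 <= s <= b -> {for s, continuous (g w)}) ->
  (forall w s, D w -> 0 <= s <= b -> {for w, continuous (g^~ s)}) ->
  exists r : X -> R, forall w, D w ->
    [/\ 0 <= r w <= b, g w (r w) = c & {for w, continuous r}].
Proof.
move=> oD b0 gc gmono gcont wcont.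
have /choice[r rP] : forall w, exists t, D w -> 0 <= t <= b /\ g w t = c.
  move=> w; have [Dw|nD] := pselect (D w); last by exists 0.
  have /andP[c0 cb] := gc w Dw.
  have /(IVT (ltW b0)) : {within `[0, b], continuous (g w)}.
    apply: continuous_in_subspaceT => s; rewrite inE /= in_itv => sb.
    exact: gcont.
  move=> /(_ c)[|t]; first by rewrite ge_min c0 le_max cb orbT.
  by rewrite in_itv => tb <-; exists t.
exists r => w Dw; have [/andP[r0 rb] rc] := rP w Dw; split=> //; first by rewrite r0.
have nD : \forall x \near w, D x by apply: open_nbhs_nbhs.
have below s : 0 <= s -> s < r w -> \forall x \near w, s < r x.
  move=> s0 sr; have sb : 0 <= s <= b by rewrite s0 (le_trans (ltW sr)).
  have lt : g w s < c by rewrite -rc gmono.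
  have ltx : \forall x \near w, g x s < c by exact: cvgr_lt (wcont w s Dw sb) _ lt.
  near=> x; have Dx : D x by near: x.
  have : g x s < c by near: x.
  rewrite -(rP x Dx).2; apply: contraTT; rewrite -!leNgt le_eqVlt.
  case/predU1P => [->//|rs]; apply: ltW; apply: gmono => //.
    by have [/andP[]] := rP x Dx.
  by case/andP: sb.
have above s : s <= b -> r w < s -> \forall x \near w, r x < s.
  move=> s0 sr; have sb : 0 <= s <= b by rewrite s0 (le_trans r0 (ltW sr)).
  have lt : c < g w s by rewrite -rc gmono.
  have ltx : \forall x \near w, c < g x s by exact: cvgr_gt (wcont w s Dw sb) _ lt.
  near=> x; have Dx : D x by near: x.
  have : c < g x s by near: x.
  rewrite -(rP x Dx).2; apply: contraTT; rewrite -!leNgt le_eqVlt.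
  case/predU1P => [->//|rs]; apply: ltW; apply: gmono => //.
    by case/andP: sb.
  by have [/andP[]] := rP x Dx.
apply/cvgrPdist_lt => e e0.
have lo : \forall x \near w, r w - e < r x.
  have [big|small] := ltrP (r w - e) 0; last by apply: below => //; lra.
  near=> x; have Dx : D x by near: x.
  by have [/andP[x0 xb] _] := rP x Dx; lra.
have hi : \forall x \near w, r x < r w + e.
  have [big|small] := ltrP b (r w + e); last by apply: above => //; lra.
  near=> x; have Dx : D x by near: x.
  by have [/andP[x0 xb] _] := rP x Dx; lra.
near=> x; rewrite distrC ltr_distl; apply/andP; split; near: x.
  exact: lo.
exact: hi.
Unshelve. all: by end_near.
Qed.

(** * An antipodal family of planes *)

Section Planes.
Variables (R : realType) (n p : nat).
Hypothesis pn : (p + p <= n.+1)%N.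

Definition complex_structure : 'M[R]_(p + p) :=
  block_mx 0 1%:M (- 1%:M) 0.

Definition embed : 'M[R]_(p + p, n.+1) := pid_mx (p + p).

(** The plane attached to w is spanned by w and i w, where i is the complex structure
    of R^(2p), which is embedded in R^(n+1): these are orthogonal vectors of the same
    length which depend linearly, hence oddly, on w. *)
Definition plane_u (w : 'rV[R]_(p + p)) := w *m embed.
Definition plane_v (w : 'rV[R]_(p + p)) := w *m (complex_structure *m embed).

Lemma plane_uN w : plane_u (- w) = - plane_u w.
Proof. exact: mulNmx. Qed.

Lemma plane_vN w : plane_v (- w) = - plane_v w.
Proof. exact: mulNmx. Qed.

Lemma complex_structure_tr : complex_structure^T = - complex_structure.
Proof.
by rewrite /complex_structure tr_block_mx opp_block_mx !raddfN /= !trmx1 !trmx0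
  oppr0 opprK.
Qed.

Lemma complex_structure_mul : complex_structure *m complex_structure^T = 1%:M.
Proof.
rewrite complex_structure_tr mulmxN /complex_structure mulmx_block.
rewrite !mul0mx !mulmx0 mulNmx mulmxN !mulmx1 !addr0 !add0r opp_block_mx.
by rewrite !opprK oppr0 [RHS]scalar_mx_block.
Qed.

Lemma dot_embed x y : dot (x *m embed) (y *m embed) = dot x y.
Proof.
rewrite !dot_mxE trmx_mul mulmxA -(mulmxA x) /embed tr_pid_mx mul_pid_mx.
by rewrite minnn (minn_idPr pn) pid_mx_1 mulmx1.
Qed.

Lemma plane_frame w : w != 0 -> frame (plane_u w) (plane_v w).
Proof.
move=> w0; rewrite /frame /plane_u /plane_v mulmxA -dot_eq0 !dot_embed dot_eq0; split=> //.
  have : dot w (w *m complex_structure) = - dot (w *m complex_structure) w.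
    rewrite !dot_mxE trmx_mul complex_structure_tr mulNmx mulmxN mulmxA.
    by rewrite mxE.
  rewrite (dotC _ w).
  lra.
by rewrite !dot_mxE trmx_mul mulmxA -(mulmxA w) complex_structure_mul mulmx1.
Qed.

Lemma plane_continuous (A : 'M[R]_(p + p, n.+1)) z (w : 'rV[R]_(p + p)) :
  {for w, continuous (fun x : 'rV[R]_(p + p) => dot z (x *m A))}.
Proof.
have E (x : 'rV[R]_(p + p)) : dot z (x *m A) = dot (z *m A^T) x.
  by rewrite !dot_mxE trmx_mul mulmxA.
rewrite (funext E).
by apply: dot_continuous; [exact: for_continuous_cst|].
Qed.

End Planes.

(** * Balanced fans *)

Section Balanced.
Variables (R : realType) (n p : nat).
Hypothesis pn : (p + p <= n.+1)%N.
Notation V := 'rV[R]_(p + p).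
Notation U w := (plane_u n w).
Notation W w := (plane_v n w).
Notation nonzero := [set w : V | w != 0].
Implicit Types w : V.

Lemma open_nonzero : open nonzero.
Proof.
rewrite (_ : nonzero = ~` [set 0]); last first.
  by apply/seteqP; split=> w /= /eqP.
apply: closed_openC; apply: compact_closed; last exact: compact_set1.
exact: norm_hausdorff.
Qed.

Lemma plane_arc_continuous (mu : probability (borel_sphere R n) R)
    (X : pseudoMetricType R) (x0 : X) (f : X -> V) (th ph : X -> R) :
  proper_measure mu -> {for x0, continuous f} -> f x0 != 0 ->
  {for x0, continuous th} -> {for x0, continuous ph} ->
  th x0 <= ph x0 -> ph x0 <= th x0 + 2 * pi ->
  {for x0, continuous (fun x => arc_mass mu (U (f x)) (W (f x)) (th x) (ph x))}.
Proof.
move=> pmu cf f0 cth cph h1 h2; apply: arc_mass_continuous => //.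
- move=> z.
  exact: (continuous_comp cf (@plane_continuous R n p (embed R n p) z (f x0))).
- move=> z.
  exact: (continuous_comp cf (@plane_continuous R n p (_ *m _) z (f x0))).
- exact: plane_frame.
Qed.

Variable lambda : probability (borel_sphere R n) R.
Hypothesis proper_lambda : proper_measure lambda.
Notation mass_ w := (arc_mass lambda (U w) (W w)).

Let frame_ (w : V) : w != 0 -> frame (U w) (W w).
Proof. exact: plane_frame. Qed.

Lemma sym_arc_lt w s t : w != 0 -> 0 <= s -> s < t -> t <= pi ->
  mass_ w (- s) s < mass_ w (- t) t.
Proof.
move=> w0 s0 st tpi; have fr := frame_ w0.
rewrite (@arc_mass_split _ _ lambda proper_lambda _ _ (- t) (- s) t fr); try lra.
rewrite (@arc_mass_split _ _ lambda proper_lambda _ _ (- s) s t fr); try lra.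
have := @arc_mass_gt0 _ _ lambda proper_lambda _ _ s t fr st.
have := @arc_mass_ge0 _ _ lambda (U w) (W w) (- t) (- s).
lra.
Qed.

(** Among the arcs bisected by [plane_u w], the mass grows strictly and continuously
    from 0 to 1 with the opening, so one of them has half the mass. *)
Lemma half_arc_exists : exists s : V -> R, forall w, w != 0 ->
  [/\ 0 <= s w <= pi, mass_ w (- s w) (s w) = 2^-1 & {for w, continuous s}].
Proof.
have p0 := pi_gt0 R.
apply: (@implicit_root R V nonzero pi 2^-1 (fun w s => mass_ w (- s) s)) => //.
- exact: open_nonzero.
- move=> w w0; rewrite oppr0 arc_mass_empty //.
  have -> : mass_ w (- pi) pi = 1.
    rewrite -[RHS](arc_mass_turn proper_lambda (- pi) (frame_ w0)).
    by congr (mass_ w _ _); lra.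
  by apply/andP; split; lra.
- by move=> w s t; apply: sym_arc_lt.
- move=> w s w0 /andP[s0 sp].
  apply: (@plane_arc_continuous lambda R s (fun=> w) (fun s => - s) id) => //; last 2 first.
  + lra.
  + lra.
  + exact: for_continuous_cst.
  + by apply: cvgN.
- move=> w s w0 /andP[s0 sp].
  apply: (@plane_arc_continuous lambda V w id (fun=> - s) (fun=> s)) => //; last 2 first.
  + lra.
  + lra.
  + exact: for_continuous_cst.
  + exact: for_continuous_cst.
Qed.

Variable s : V -> R.
Hypothesis sP : forall w, w != 0 ->
  [/\ 0 <= s w <= pi, mass_ w (- s w) (s w) = 2^-1 & {for w, continuous s}].

(** The arc attached to - w is the complement of the arc attached to w: the complement
    also has half the mass, and it is bisected by [plane_u (- w)]. *)
Lemma half_arcN w : w != 0 -> s (- w) = pi - s w.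
Proof.
move=> w0; have nw0 : - w != 0 by rewrite oppr_eq0.
have [/andP[a1 a2] a3 _] := sP w0; have [/andP[b1 b2] b3 _] := sP nw0.
have fr := frame_ w0.
set q := pi - s (- w).
have mq : mass_ w (- q) q = 2^-1.
  have := arc_mass_turn proper_lambda (- q) fr.
  rewrite (@arc_mass_split _ _ lambda proper_lambda _ _ (- q) q _ fr); rewrite /q; try lra.
  move: b3; rewrite plane_uN plane_vN arc_massN.
  rewrite (_ : - s (- w) + pi = pi - s (- w)); last lra.
  rewrite (_ : - (pi - s (- w)) + 2 * pi = s (- w) + pi); last lra.
  lra.
have [lt|gt|] := ltgtP q (s w); last by rewrite /q; lra.
- have q0 : 0 <= q by rewrite /q; lra.
  by have := sym_arc_lt w0 q0 lt a2; rewrite mq a3 ltxx.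
- have qpi : q <= pi by rewrite /q; lra.
  by have := sym_arc_lt w0 a1 gt qpi; rewrite mq a3 ltxx.
Qed.

Lemma cut_angle_exists c : 0 <= c <= 1 ->
  exists r : V -> R, forall w, w != 0 ->
    [/\ 0 <= r w <= 2 * pi, mass_ w (- s w) (r w - s w) = c &
        {for w, continuous r}].
Proof.
move=> /andP[c0 c1]; have p0 := pi_gt0 R.
apply: (@implicit_root R V nonzero (2 * pi) c
  (fun w t => mass_ w (- s w) (t - s w))) => //.
- exact: open_nonzero.
- by rewrite mulr_gt0.
- move=> w w0; rewrite sub0r arc_mass_empty // c0 addrC.
  by rewrite (arc_mass_turn proper_lambda (- s w) (frame_ w0)).
- move=> w t t' w0 t0 tt' t'2; apply: (arc_mass_lt proper_lambda (frame_ w0)); lra.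
- move=> w t w0 /andP[t0 t2].
  apply: (@plane_arc_continuous lambda R t (fun=> w) (fun=> - s w) (fun t => t - s w)) => //; last 2 first.
  + lra.
  + lra.
  + exact: for_continuous_cst.
  + exact: for_continuous_cst.
  + by apply: cvgB => //; exact: cvg_cst.
- move=> w t w0 /andP[t0 t2]; have [_ _ cs] := sP w0.
  apply: (@plane_arc_continuous lambda V w id (fun w => - s w) (fun w => t - s w)) => //; last 2 first.
  + lra.
  + lra.
  + exact: (cvgN cs).
  + exact: (cvgB (@for_continuous_cst V R t w) cs).
Qed.

Variables (k : nat) (A : nat -> R).
Hypotheses (A0 : A 0 = 0) (Ak : A k = 2^-1).
Hypothesis A_lt : forall t, (t < k)%N -> A t < A t.+1.

Let A_range t : (t <= k)%N -> 0 <= A t <= 2^-1.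
Proof.
move=> tk; apply/andP; split.
  elim: t tk => [|t IH] tk; first by rewrite A0.
  by rewrite (le_trans (IH (ltnW tk))) // ltW // A_lt.
rewrite -Ak -(subKn tk); elim: (k - t)%N => [|i IH]; first by rewrite subn0.
have [ik|ki] := ltnP i k; last first.
  by rewrite (eqP (leqW ki)) -(eqP ki).
rewrite (le_trans _ IH) // ltW // -(subnSK ik) A_lt //.
by rewrite ltn_subrL (leq_ltn_trans _ ik).
Qed.

(** Inside the arc of half the mass, the cuts are determined by the mass to the left of
    them. This gives the first k + 1 cuts of the fan, from one side of that arc to
    the other one. *)
Lemma half_fan_exists : exists a : nat -> V -> R, forall w, w != 0 ->
  [/\ a 0 w = - s w, a k w = s w,
      forall t, (t < k)%N -> a t w < a t.+1 w,
      forall t, (t < k)%N -> mass_ w (a t w) (a t.+1 w) = A t.+1 - A t &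
      forall t, (t <= k)%N -> {for w, continuous (a t)}].
Proof.
have /choice[r rP] : forall t, exists r : V -> R, (t <= k)%N -> forall w, w != 0 ->
    [/\ 0 <= r w <= 2 * pi, mass_ w (- s w) (r w - s w) = A t &
        {for w, continuous r}].
  move=> t; have [tk|tk] := leqP t k; last by exists (fun=> 0).
  have /andP[a1 a2] := A_range tk.
  have [|r rP] := @cut_angle_exists (A t); last by exists r.
  by apply/andP; split=> //; lra.
exists (fun t w => r t w - s w) => w w0; have fr := frame_ w0.
have [/andP[s0 spi] sm sc] := sP w0.
have rinj c c' : 0 <= c <= 2 * pi -> 0 <= c' <= 2 * pi ->
    mass_ w (- s w) (c - s w) < mass_ w (- s w) (c' - s w) -> c < c'.
  move=> /andP[c0 c2] /andP[c0' c2']; apply: contraTT; rewrite -!leNgt.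
  rewrite le_eqVlt => /predU1P[->//|cc]; apply: ltW.
  by apply: (arc_mass_lt proper_lambda fr); lra.
have p0 := pi_gt0 R.
have lt t : (t < k)%N -> r t w < r t.+1 w.
  move=> tk; have [h1 h2 _] := rP t (ltnW tk) w w0.
  by have [h3 h4 _] := rP t.+1 tk w w0; apply: rinj => //; rewrite h2 h4 A_lt.
split=> [|||t tk|t tk].
- have [/andP[h1 h1'] h2 _] := rP 0 (leq0n k) w w0.
  apply: (arc_mass_inj proper_lambda fr (th := - s w)); [|lra|].
    by apply/andP; split; lra.
  by rewrite h2 A0 arc_mass_empty.
- have [/andP[h1 h1'] h2 _] := rP k (leqnn k) w w0.
  apply: (arc_mass_inj proper_lambda fr (th := - s w)); [|lra|].
    by apply/andP; split; lra.
  by rewrite h2 Ak sm.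
- by move=> t tk; have := lt t tk; lra.
- have [/andP[h1 h1'] h2 _] := rP t (ltnW tk) w w0.
  have [/andP[h3 h3'] h4 _] := rP t.+1 tk w w0; have := lt t tk => ltt.
  rewrite -h2 -h4 (@arc_mass_split _ _ lambda proper_lambda _ _ (- s w)
    (r t w - s w) (r t.+1 w - s w) fr); lra.
- by have [_ _ rc] := rP t tk w w0; exact: (cvgB rc sc).
Qed.

Variables (I : finType) (mu : I -> probability (borel_sphere R n) R).
Hypothesis proper_mu : forall i, proper_measure (mu i).
Hypothesis kI : (k * #|I| < p + p)%N.

(** The second half of the fan of w is the first half of the fan of - w. Hence the
    difference between the masses of opposite orthants has the form h w - h (- w), an
    odd function of w, and the Borsuk-Ulam theorem makes all of them vanish. *)
Lemma balanced_half_fan (a : nat -> V -> R) :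
  (forall w, w != 0 -> [/\ a 0 w = - s w, a k w = s w,
      forall t, (t < k)%N -> a t w < a t.+1 w,
      forall t, (t < k)%N -> mass_ w (a t w) (a t.+1 w) = A t.+1 - A t &
      forall t, (t <= k)%N -> {for w, continuous (a t)}]) ->
  exists2 w : V, w != 0 & forall (t : 'I_k) i,
    arc_mass (mu i) (U w) (W w) (a t w) (a t.+1 w) =
    arc_mass (mu i) (U (- w)) (W (- w)) (a t (- w)) (a t.+1 (- w)).
Proof.
move=> aP.
pose h (ti : 'I_k * I) (w : V) :=
  arc_mass (mu ti.2) (U w) (W w) (a ti.1 w) (a ti.1.+1 w).
have hc ti (w : V) : w != 0 -> {for w, continuous (h ti)}.
  case: ti => t i w0; have [a0 ak alt _ ac] := aP w w0.
  have [/andP[s0 spi] _ _] := sP w0.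
  have tk := ltn_ord t.
  have amono j l : (j <= l)%N -> (l <= k)%N -> a j w <= a l w.
    move=> /subnK<-; elim: (l - j)%N => // q IH qk.
    by rewrite (le_trans (IH (ltnW qk))) // ltW // alt.
  have l0 := amono 0%N t (leq0n _) (ltnW tk); have lk := amono t.+1 k tk (leqnn k).
  apply: (@plane_arc_continuous (mu i) V w id (a t) (a t.+1)) => //.
  - exact: ac (ltnW tk).
  - exact: ac tk.
  - exact/ltW/alt.
  - by have p0 := pi_gt0 R; lra.
have [|||w w0 hw] := @borsuk_ulam R (p + p) ('I_k * I)%type
  (fun ti w => h ti w - h ti (- w)).
- by rewrite card_prod card_ord.
- move=> ti w w0; have nw0 : - w != 0 by rewrite oppr_eq0.
  apply: (cvgB (hc ti w w0)).
  have cN : {for w, continuous (fun w : V => - w)} by exact: opp_continuous.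
  exact: (continuous_comp cN (hc ti (- w) nw0)).
- by move=> ti w; rewrite opprK opprB.
exists w => // t i; apply/eqP; rewrite -subr_eq0; apply/eqP; exact: (hw (t, i)).
Qed.

End Balanced.

(** The common source of both partition theorems: lambda is cut in the proportions
    prescribed by the partial sums A, and the other measures are balanced between
    opposite orthants. A balanced fan exists for some w; its angles are those of the
    half fan of w, followed by those of the half fan of - w turned by pi. *)
Theorem balanced_angles (R : realType) (n k : nat) (A : nat -> R) (I : finType)
    (lambda : probability (borel_sphere R n) R)
    (mu : I -> probability (borel_sphere R n) R) :
  (0 < k)%N -> (k * #|I| < n)%N ->
  proper_measure lambda -> (forall i, proper_measure (mu i)) ->
  A 0 = 0 -> A k = 2^-1 -> (forall t, (t < k)%N -> A t < A t.+1) ->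
  exists u v (th : nat -> R),
  [/\ [/\ dot u u = 1, dot v v = 1 & dot u v = 0],
      forall t, (t < k + k)%N -> th t < th t.+1,
      th (k + k)%N = th 0 + 2 * pi,
      forall t, (t < k)%N ->
        arc_mass lambda u v (th t) (th t.+1) = A t.+1 - A t /\
        arc_mass lambda u v (th (k + t)%N) (th (k + t).+1) = A t.+1 - A t &
      forall t i, (t < k)%N ->
        arc_mass (mu i) u v (th t) (th t.+1) =
        arc_mass (mu i) u v (th (k + t)%N) (th (k + t).+1)].
Proof.
move=> k0 kn pl pm A0 Ak Alt.
(* The largest even dimension 2p that fits in R^(n+1); it is at least n. *)
pose p := uphalf n.
have pn : (p + p <= n.+1)%N.
  by rewrite addnn /p uphalfE -[leqRHS]odd_double_half leq_addl.
have np : (n <= p + p)%N.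
  by rewrite addnn /p uphalf_half doubleD -[leqLHS]odd_double_half leq_add2r; case: odd.
have [s sP] := half_arc_exists pn pl.
have [a aP] := half_fan_exists pn pl sP A0 Ak Alt.
have [w w0 bal] := balanced_half_fan pn sP pm (leq_trans kn np) aP.
have nw0 : - w != 0 by rewrite oppr_eq0.
have [a0 ak alt am _] := aP w w0; have [b0 bk blt bm _] := aP _ nw0.
have sN := half_arcN pn pl sP w0.
pose th t := if (t < k)%N then a t w else a (t - k)%N (- w) + pi.
have th1 t : (t <= k)%N -> th t = a t w.
  rewrite leq_eqVlt /th => /predU1P[->|->//].
  by rewrite ltnn subnn b0 ak sN; ring.
have th2 t : th (k + t)%N = a t (- w) + pi.
  by rewrite /th ltnNge leq_addr /= addKn.
pose c := (Num.sqrt (dot (plane_u n w) (plane_u n w)))^-1.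
have [u0 uv uu] := plane_frame pn w0.
have c0 : 0 < c.
  by rewrite invr_gt0 sqrtr_gt0 lt_neqAle dot_ge0 eq_sym dot_eq0 u0.
have cc : c * (c * dot (plane_u n w) (plane_u n w)) = 1.
  rewrite /c mulrA -invfM -expr2 sqr_sqrtr ?dot_ge0 // mulVf //.
  by rewrite dot_eq0.
have arcs (m : probability (borel_sphere R n) R) t : (t < k)%N ->
    arc_mass m (c *: plane_u n w) (c *: plane_v n w) (th (k + t)%N) (th (k + t).+1) =
    arc_mass m (plane_u n (- w)) (plane_v n (- w)) (a t (- w)) (a t.+1 (- w)).
  by move=> tk; rewrite arc_massZ // -addnS !th2 plane_uN plane_vN arc_massN.
exists (c *: plane_u n w), (c *: plane_v n w), th; split.
- by rewrite !dotZl !dotZr -uu uv !mulr0 cc.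
- move=> t tk; have [h|h] := ltnP t k; first by rewrite !th1 ?alt // ltnW.
  rewrite -(subnKC h) -addnS !th2 ltrD2r blt // ltn_subLR //.
- by rewrite th2 th1 // bk sN a0; ring.
- move=> t tk; rewrite arcs // bm //; split=> //.
  by rewrite arc_massZ // !th1 ?am // ltnW.
- move=> t i tk; rewrite arcs // -(bal (Ordinal tk)) arc_massZ //.
  by rewrite !th1 // ltnW.
Qed.

(** * The fan with given angles *)

Section Angles.
Variable R : realType.
Implicit Types th ph psi t a b : R.

Lemma cos_sin_2pi_int th (m : int) :
  cos (th + 2 * pi * m%:~R) = cos th /\ sin (th + 2 * pi * m%:~R) = sin th.
Proof.
have nat_case (x : R) (q : nat) :
    cos (x + 2 * pi * q%:R) = cos x /\ sin (x + 2 * pi * q%:R) = sin x.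
  rewrite (_ : 2 * pi * q%:R = (pi *+ 2) *+ q); last first.
    by rewrite -[RHS]mulr_natr -[pi *+ 2]mulr_natl.
  by rewrite (periodicn (@cosD2pi R)) (periodicn (@sinD2pi R)).
case: m => q; first exact: nat_case.
have [<- <-] := nat_case (th + 2 * pi * (Negz q)%:~R) q.+1.
by rewrite NegzE mulrNz mulrN subrK.
Qed.

Lemma cos_sin_eq th ph : cos th = cos ph -> sin th = sin ph ->
  exists m : int, th = ph + 2 * pi * m%:~R.
Proof.
move=> ec es; have p0 := pi_gt0 R.
pose m := Num.floor ((th - ph) / (2 * pi)); exists m.
have p2 : 0 < 2 * pi :> R by rewrite mulr_gt0.
have d0 : 0 <= th - ph - 2 * pi * m%:~R.
  rewrite subr_ge0 mulrC -ler_pdivlMr //; exact: floor_le_tmp.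
have d1 : th - ph - 2 * pi * m%:~R < 2 * pi.
  rewrite ltrBlDr (_ : 2 * pi + 2 * pi * m%:~R = (m%:~R + 1) * (2 * pi)); last by ring.
  rewrite -ltr_pdivrMr //.
  by have := floorD1_gt ((th - ph) / (2 * pi)); rewrite intrD.
suff : th - ph - 2 * pi * m%:~R = 0 by lra.
apply/eqP; rewrite eq_le d0 andbT leNgt; apply/negP => dp.
have : cos (th - ph - 2 * pi * m%:~R) < 1 by apply: cos_lt1; rewrite dp.
have [c _] := cos_sin_2pi_int (th - ph - 2 * pi * m%:~R) m.
rewrite -c subrK cosB ec es -!expr2 cos2Dsin2 ltxx //.
Qed.

Lemma polar_int th t a b (m : int) :
  polar (th + 2 * pi * m%:~R) t a b <-> polar th t a b.
Proof. by rewrite /polar; have [-> ->] := cos_sin_2pi_int th m. Qed.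

Lemma polar_unit th t ph : polar th t (cos ph) (sin ph) ->
  exists m : int, ph = th + 2 * pi * m%:~R.
Proof.
move=> [t0 ec es]; have t1 : t = 1.
  have := cos2Dsin2 ph; rewrite ec es !exprMn -mulrDr cos2Dsin2 mulr1.
  by move/eqP; rewrite sqrp_eq1 ?ltW // => /eqP.
by apply: cos_sin_eq; rewrite ?ec ?es t1 mul1r.
Qed.

Lemma cross_eq0_polar th a b : cross th a b = 0 -> (a, b) != (0, 0) ->
  exists t, polar th t a b \/ polar (th + pi) t a b.
Proof.
rewrite /cross => c0 ab0; pose l := a * cos th + b * sin th.
have c1 := cos2Dsin2 th.
have ea : a = l * cos th.
  transitivity (a * (cos th ^+ 2 + sin th ^+ 2) + (b * cos th - a * sin th) * sin th).
    by rewrite c1 c0 mul0r addr0 mulr1.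
  by rewrite /l; ring.
have eb : b = l * sin th.
  transitivity (b * (cos th ^+ 2 + sin th ^+ 2) - (b * cos th - a * sin th) * cos th).
    by rewrite c1 c0 mul0r subr0 mulr1.
  by rewrite /l; ring.
have [l0|l0|l0] := ltgtP l 0.
- exists (- l); right; apply/polarDpi; split; rewrite ?oppr_gt0 //.
    by rewrite {1}ea mulNr.
  by rewrite {1}eb mulNr.
- by exists l; left.
- by move: ab0; rewrite ea eb l0 !mul0r eqxx.
Qed.

Lemma crossDpi th a b : cross (th + pi) a b = - cross th a b.
Proof. by rewrite /cross cosDpi sinDpi; ring. Qed.

Lemma cross_eq0_origin th ph a b : th < ph < th + pi ->
  cross th a b = 0 -> cross ph a b = 0 -> a = 0 /\ b = 0.
Proof.
rewrite /cross => /andP[h1 h2] c1 c2.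
have s0 : sin (ph - th) != 0.
  by rewrite gt_eqF // sin_gt0_pi //; apply/andP; split; lra.
rewrite sinB in s0.
split; apply: (mulfI s0); rewrite mulr0.
  transitivity (cos ph * (b * cos th - a * sin th) * -1 * -1
                - cos th * (b * cos ph - a * sin ph)); first ring.
  by rewrite c1 c2; ring.
transitivity (sin ph * (b * cos th - a * sin th)
              - sin th * (b * cos ph - a * sin ph)); first ring.
by rewrite c1 c2; ring.
Qed.

End Angles.

(** ** Half-hyperplanes *)

Section FanOf.
Variables (R : realType) (n : nat) (u v : 'rV[R]_n.+1).
Hypotheses (uu : dot u u = 1) (vv : dot v v = 1) (uv : dot u v = 0).
Implicit Types (x y : 'rV[R]_n.+1) (th ph : R).

Definition fan_space : {vspace 'rV[R]_n.+1} := null_space (col_mx u v)^T.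

Lemma mem_fan_space x : (x \in fan_space) = (dot x u == 0) && (dot x v == 0).
Proof.
rewrite mem_null_space tr_col_mx mul_mx_row row_mx_eq0.
by rewrite -!mem_null_space -!/(hyperplane _) !mem_hyperplane.
Qed.

Lemma dim_fan_space : (\dim fan_space).+2 = n.+1.
Proof.
rewrite -addn2; apply: (@dim_null_space _ _ (1 + 1) _ (col_mx u v)).
rewrite tr_col_mx mul_col_row [RHS]scalar_mx_block; congr block_mx.
all: apply/matrixP => i j; rewrite !ord1 -dot_mxE ?(dotC v u) ?uu ?vv ?uv !mxE ?eqxx //.
Qed.

Definition half_at th : set 'rV[R]_n.+1 :=
  [set x | exists t, polar th t (dot x u) (dot x v)].

Definition plane_at th := hyperplane (cut_normal u v th).

Lemma frame_uv : frame u v.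
Proof. by split; rewrite ?uu ?vv // -dot_eq0 uu oner_eq0. Qed.

Lemma mem_plane_at th x : (x \in plane_at th) = (cross th (dot x u) (dot x v) == 0).
Proof. by rewrite mem_hyperplane cut_normalE. Qed.

Lemma dim_plane_at th : (\dim (plane_at th)).+1 = n.+1.
Proof. by apply: dim_hyperplane; apply: cut_normal_neq0; exact: frame_uv. Qed.

Lemma fan_space_sub th : (fan_space <= plane_at th)%VS.
Proof.
apply/subvP => x; rewrite mem_fan_space mem_plane_at => /andP[/eqP-> /eqP->].
by rewrite /cross !mul0r subrr.
Qed.

Lemma dot_circ th : dot (circ u v th) u = cos th /\ dot (circ u v th) v = sin th.
Proof.
rewrite /circ !dotDl !dotZl uu vv uv (dotC v u) uv.
by rewrite !mulr1 !mulr0 addr0 add0r.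
Qed.

Lemma half_at_circ th : half_at th (circ u v th).
Proof.
by have [e1 e2] := dot_circ th; exists 1; split; rewrite ?mul1r.
Qed.

Lemma half_at_sub th : half_at th `<=` [set` plane_at th] `\` [set` fan_space].
Proof.
move=> x [t p]; split=> /=; first by rewrite mem_plane_at (cross_angle p).
rewrite mem_fan_space => /andP[/eqP a0 /eqP b0]; case: p => t0.
rewrite a0 b0 => /esym/eqP; rewrite mulf_eq0 gt_eqF //= => /eqP c0 /esym/eqP.
rewrite mulf_eq0 gt_eqF //= => /eqP s0.
have := cos2Dsin2 th; rewrite c0 s0 expr0n addr0 => /eqP.
by rewrite eq_sym oner_eq0.
Qed.

Lemma connected_half_at th : connected (half_at th).
Proof.
pose x0 := circ u v th.
have [e1 e2] : dot x0 u = cos th /\ dot x0 v = sin th := dot_circ th.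
pose seg y := (fun s : R => x0 + s *: (y - x0)) @` `[0, 1].
rewrite (_ : half_at th = \bigcup_(y in half_at th) seg y).
  apply: bigcup_connected.
    exists x0 => y _; exists 0; first by rewrite /= in_itv /= lexx ler01.
    by rewrite scale0r addr0.
  move=> y _; apply: connected_continuous_connected; first exact: segment_connected.
  apply: continuous_subspaceT => s.
  apply: cvgD; first exact: cvg_cst.
  by apply: cvgZr_tmp; exact: cvg_id.
apply/seteqP; split=> [y hy|x [y [t [t0 ea eb]] [s]]].
  exists y => //; exists 1; first by rewrite /= in_itv /= lexx ler01.
  by rewrite scale1r addrC subrK.
rewrite /= in_itv /= => /andP[s0 s1] <-.
have E z : dot (x0 + s *: (y - x0)) z = dot x0 z + s * (dot y z - dot x0 z).
  by rewrite dotDl dotZl dotDl dotNl.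
exists ((1 - s) + s * t); rewrite !E e1 e2 ea eb; split.
- have [->|sn] := eqVneq s 0; first by rewrite subr0 mul0r addr0.
  by rewrite ltr_wpDl ?subr_ge0 // mulr_gt0 // lt_neqAle eq_sym sn.
- by ring.
- by ring.
Qed.

(** A half-hyperplane is convex, hence connected, and the sign of the inner product with
    [circ u v th] separates it from its opposite. *)
Lemma half_at_half_hyperplane th : half_hyperplane fan_space (half_at th).
Proof.
exists (plane_at th); split.
- exact: dim_plane_at.
- exact: fan_space_sub.
- by apply: succn_inj; rewrite dim_fan_space dim_plane_at.
have [e1 e2] := dot_circ th.
exists (circ u v th); first by apply: half_at_sub; exact: half_at_circ.
apply/seteqP; split.
  by apply: connected_component_max;
    [exact: half_at_circ|exact: half_at_sub|exact: connected_half_at].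
(* The image of a connected set under an inner product is an interval; if it contains
   1 and a negative number, it contains 0, which is only reached on the axis. *)
move=> y [C [Cx Csub Cc] Cy].
pose l x := dot x (circ u v th).
have lE x : l x = dot x u * cos th + dot x v * sin th.
  by rewrite /l /circ dotDr !dotZr mulrC [sin _ * _]mulrC.
have /connected_intervalP itv : connected (l @` C).
  apply: connected_continuous_connected => //; apply: continuous_subspaceT => x.
  by apply: (@dot_continuous R n.+1 _ id (fun=> circ u v th) x) => //;
    exact: for_continuous_cst.
have [Hy Ly] := Csub _ Cy.
have [t [//|p]] : exists t, polar th t (dot y u) (dot y v) \/
    polar (th + pi) t (dot y u) (dot y v).
  apply: cross_eq0_polar; first by apply/eqP; rewrite -mem_plane_at.
  by apply: contraPneq Ly => -[a0 b0] /=; rewrite mem_fan_space a0 b0 eqxx; apply.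
  by exists t.
exfalso; have ly : l y < 0.
  rewrite lE; case: p => t0 -> ->; rewrite cosDpi sinDpi.
  have := cos2Dsin2 th; rewrite !expr2 => c1; nra.
have lx : l (circ u v th) = 1 by rewrite lE e1 e2 -!expr2 cos2Dsin2.
have [z Cz lz] : (l @` C) 0.
  apply: (itv (l y) (l (circ u v th))); first by exists y.
    by exists (circ u v th).
  by rewrite lx ler01 ltW.
have [Hz []] := Csub _ Cz; rewrite /= mem_fan_space.
have := cos2Dsin2 th; move: Hz; rewrite /= mem_plane_at /cross => /eqP cz c1.
rewrite lE in lz.
apply/andP; split; apply/eqP.
  transitivity (dot z u * (cos th ^+ 2 + sin th ^+ 2)); first by rewrite c1 mulr1.
  transitivity (cos th * (dot z u * cos th + dot z v * sin th)
     - sin th * (dot z v * cos th - dot z u * sin th)); first ring.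
  by rewrite lz cz !mulr0 subr0.
transitivity (dot z v * (cos th ^+ 2 + sin th ^+ 2)); first by rewrite c1 mulr1.
transitivity (sin th * (dot z u * cos th + dot z v * sin th)
     + cos th * (dot z v * cos th - dot z u * sin th)); first ring.
by rewrite lz cz !mulr0 addr0.
Qed.

(** ** The fan record *)

Variables (r : nat) (th : nat -> R).
Hypothesis th_lt : forall t, (t < r)%N -> th t < th t.+1.
Hypothesis th_turn : th r = th 0 + 2 * pi.

Lemma angles_lt i j : (i < j)%N -> (j <= r)%N -> th i < th j.
Proof.
move=> /subnK<-; elim: (j - i.+1)%N => [|q IH] qr; first exact: th_lt.
by apply: lt_trans (IH (ltnW qr)) _; exact: th_lt.
Qed.

Lemma angles_le i j : (i <= j)%N -> (j <= r)%N -> th i <= th j.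
Proof.
rewrite leq_eqVlt => /predU1P[->//|ij] jr; exact/ltW/angles_lt.
Qed.

Lemma angles_turn i j : (i < r)%N -> (j < r)%N -> th j < th i + 2 * pi.
Proof.
move=> ir jr; rewrite (lt_le_trans (angles_lt jr (leqnn r))) // th_turn lerD2r.
exact: angles_le (leq0n _) (ltnW ir).
Qed.

Definition half_of (i : 'I_r) := half_at (th i).

Lemma half_of_inj : injective half_of.
Proof.
suff wlog_inj (i j : 'I_r) : (i <= j)%N -> half_of i = half_of j -> i = j.
  move=> i j e; have [|/ltnW] := leqP i j; first by move/wlog_inj/(_ e).
  by move/wlog_inj => h; exact/esym/h.
move=> ij e; apply: contrapT => /eqP ne.
have lt : (i < j)%N by rewrite ltn_neqAle ij andbT.
have [e1 e2] := dot_circ (th i).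
have [t p] : half_of j (circ u v (th i)) by rewrite -e; exact: half_at_circ.
have thlt := angles_lt lt (ltnW (ltn_ord j)).
have thtu := angles_turn (ltn_ord i) (ltn_ord j).
have [t' p'] := half_at_circ (th i).
have := polar_angle_eq p' p; rewrite ltrBlDl subr_ge0 ltW // thtu => /(_ isT).
by move/eqP; rewrite lt_eqF.
Qed.

Lemma fan_space_perp x : x \in fan_space -> dot x u = 0 /\ dot x v = 0.
Proof. by rewrite mem_fan_space => /andP[/eqP-> /eqP->]. Qed.

Lemma half_of_cyclic : exists theta : 'I_r -> R,
  [/\ forall i, half_of i (circ u v (theta i)),
      forall i j : 'I_r, (i < j)%N -> theta i < theta j &
      forall i j : 'I_r, theta j < theta i + 2 * pi].
Proof.
exists (fun i => th i); split=> [i|i j ij|i j]; first exact: half_at_circ.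
  exact: angles_lt ij (ltnW (ltn_ord j)).
exact: angles_turn.
Qed.

Definition fan_of : fan R n.+1 r :=
  Fan dim_fan_space (And3 uu vv uv) fan_space_perp
    (fun i : 'I_r => half_at_half_hyperplane (th i)) half_of_inj half_of_cyclic.

Lemma half_at2pi a : half_at (a + 2 * pi) = half_at a.
Proof. by apply/seteqP; split=> x [t /polar2pi p]; exists t => //; exact/polar2pi. Qed.

Lemma half_ordS (i : 'I_r) : half_at (th (ordS i)) = half_at (th i.+1).
Proof.
rewrite /=; have := ltn_ord i; rewrite leq_eqVlt => /predU1P[e|lt].
  by rewrite e modnn -half_at2pi -th_turn.
by rewrite modn_small.
Qed.

Lemma polar_circ (x : 'rV[R]_n.+1) phi t :
  x - t *: circ u v phi \in fan_space <->
  dot x u = t * cos phi /\ dot x v = t * sin phi.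
Proof.
have [e1 e2] := dot_circ phi.
rewrite mem_fan_space !dotDl !dotNl !dotZl e1 e2 !subr_eq0.
by split=> [/andP[/eqP-> /eqP->]|[-> ->]]; rewrite ?eqxx.
Qed.

(** The angles that witness membership in an orthant are only known up to full turns;
    the requirement that they differ by at most one turn fixes them up to a common
    shift. *)
Lemma orthant_fan_of (i : 'I_r) : orthant fan_of i = sphere_arc u v (th i) (th i.+1).
Proof.
have ir := ltn_ord i; have step := th_lt ir.
have turn : th i.+1 <= th i + 2 * pi.
  have [->|lt] := eqVneq i.+1 r; last first.
    by apply/ltW/angles_turn => //; rewrite ltn_neqAle lt.
  by rewrite th_turn lerD2r angles_le // ltnW.
apply/seteqP; split=> y; last first.
  move=> [phi [t [h [t0 e1 e2]]]].
  exists (th i), phi, (th i.+1); split=> //.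
  - exact: half_at_circ.
  - by rewrite /= half_ordS; exact: half_at_circ.
  - by exists t => //; apply/polar_circ.
move=> [theta [phi [theta' [/= h h' /andP[lt lt'] tu [t t0 /polar_circ[e1 e2]]]]]].
rewrite half_ordS in h'.
have ang a b : half_at a (circ u v b) -> exists m : int, b = a + 2 * pi * m%:~R.
  by have [d1 d2] := dot_circ b; case=> q; rewrite d1 d2 => /polar_unit.
have [m em] := ang _ _ h; have [m' em'] := ang _ _ h'.
have p0 := pi_gt0 R.
(* Both pairs of angles differ by a positive amount, of at most a full turn, so that
   their shifts differ by less than a turn. *)
have mm : m' = m.
  have lt1 : (m'%:~R - m%:~R : R) < 1.
    rewrite -(ltr_pM2l (_ : 0 < 2 * pi)); last by rewrite mulr_gt0.
    by rewrite mulr1 mulrBr; lra.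
  have gt1 : -1 < (m'%:~R - m%:~R : R).
    rewrite -(ltr_pM2l (_ : 0 < 2 * pi)); last by rewrite mulr_gt0.
    by rewrite mulrN1 mulrBr; lra.
  have : m' < m + 1 by rewrite -(ltr_int R) intrD; lra.
  have : m < m' + 1 by rewrite -(ltr_int R) intrD; lra.
  lia.
exists (phi - 2 * pi * m%:~R), t; split.
  by rewrite mm in em'; apply/andP; split; lra.
by apply/(polar_int _ _ _ _ m); rewrite subrK; split.
Qed.

(** The rays t and k + t are the two halves of one line, which accounts for the union.
    The k lines are distinct because the first k angles span less than pi, and two of
    them already meet in the origin only. *)
Lemma plane_at_position (k : nat) : (0 < k)%N -> r = (k + k)%N ->
  (forall t, (t <= k)%N -> th (k + t)%N = th t + pi) ->
  [/\ forall i : 'I_k, (\dim (plane_at (th i))).+1 = n.+1,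
      injective (fun i : 'I_k => plane_at (th i)),
      (1 < k)%N -> (\bigcap_(i < k) plane_at (th i))%VS = fan_space &
      \bigcup_(i in [set: 'I_k]) [set` plane_at (th i)] =
        [set` fan_space] `|` \bigcup_(t in [set: 'I_r]) half_of t].
Proof.
move=> k0 rk thpi.
have kr i : (i <= k)%N -> (i <= r)%N by rewrite rk => h; rewrite (leq_trans h) ?leq_addr.
have below i j : (i < k)%N -> (j < k)%N -> th j < th i + pi.
  move=> ik jk; rewrite -thpi ?(ltnW ik) //; apply: angles_lt.
    by rewrite (leq_trans jk) ?leq_addr.
  by rewrite rk leq_add2l ltnW.
split.
- by move=> i; exact: dim_plane_at.
- suff wlog_inj (i j : 'I_k) : (i <= j)%N -> plane_at (th i) = plane_at (th j) -> i = j.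
    move=> i j e; have [|/ltnW] := leqP i j; first by move/wlog_inj/(_ e).
    by move/wlog_inj => h; exact/esym/h.
  move=> ij e; apply: contrapT => /eqP ne.
  have lt : (i < j)%N by rewrite ltn_neqAle ij andbT.
  have [x1 x2] := half_at_sub (half_at_circ (th i)).
  apply: x2 => /=; rewrite mem_fan_space.
  have := x1; rewrite /= e mem_plane_at => /eqP c2.
  move: x1; rewrite /= mem_plane_at => /eqP c1.
  have [|-> ->] := cross_eq0_origin _ c1 c2; last by rewrite eqxx.
  by rewrite angles_lt //= ?below // kr // ltnW.
- move=> k1; apply/eqP; rewrite eqEsubv; apply/andP; split; last first.
    by apply/subv_bigcapP => i _; exact: fan_space_sub.
  apply/subvP => x xH.
  have mem (i : 'I_k) : cross (th i) (dot x u) (dot x v) = 0.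
    by apply/eqP; rewrite -mem_plane_at; apply: subvP xH; exact: bigcapv_inf.
  rewrite mem_fan_space.
  have [|-> ->] := cross_eq0_origin _ (mem (Ordinal k0)) (mem (Ordinal k1)).
    by rewrite /= angles_lt //= ?below // kr.
  by rewrite eqxx.
apply/seteqP; split=> x.
  move=> [i _] /=; rewrite mem_plane_at => /eqP c0.
  have [ab0|ab0] := eqVneq (dot x u, dot x v) (0, 0).
    by left; rewrite /= mem_fan_space; case: ab0 => -> ->; rewrite eqxx.
  right; have ik := ltn_ord i.
  have [t [p|p]] := cross_eq0_polar c0 ab0.
    have ir : (i < r)%N by rewrite rk ltn_addr.
    by exists (Ordinal ir) => //; exists t.
  have ir : (k + i < r)%N by rewrite rk ltn_add2l.
  by exists (Ordinal ir) => //; exists t; rewrite /= thpi // ltnW.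
move=> [xL|[t _ [q p]]].
  by exists (Ordinal k0) => //; apply: (subvP (fan_space_sub _)).
have [tk|kt] := ltnP t k.
  by exists (Ordinal tk) => //=; rewrite mem_plane_at (cross_angle p).
have tk : (t - k < k)%N by rewrite ltn_subLR // -rk.
exists (Ordinal tk) => //=; rewrite mem_plane_at.
move: (cross_angle p); rewrite -{1}(subnKC kt) thpi 1?ltnW // crossDpi.
by move=> /eqP; rewrite oppr_eq0.
Qed.

End FanOf.

(** * The antipodally symmetric average of a measure *)

Section Symmetrisation.
Variables (R : realType) (n : nat).

Lemma unit_sphereN (x : 'rV[R]_n.+1) :
  x \in @unit_sphere R n -> - x \in @unit_sphere R n.
Proof. by rewrite !inE /unit_sphere /= dotNl dotNr opprK. Qed.

Definition antipode (y : borel_sphere R n) : borel_sphere R n :=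
  SigSub (unit_sphereN (valP (y : sphere R n))).

Lemma to_vec_antipode (y : sphere R n) : to_vec (antipode y) = - to_vec y.
Proof. by []. Qed.

Lemma antipode_open (U : set (sphere R n)) : open U -> open (antipode @^-1` U).
Proof.
move=> [V oV <-]; exists (-%R @^-1` V); last by [].
by apply: open_comp => // x _; exact: opp_continuous.
Qed.

Lemma measurable_antipode : measurable_fun [set: borel_sphere R n] antipode.
Proof.
refine (@measurability _ _ (borel_sphere R n) (borel_sphere R n) setT antipode
  (@open (sphere R n)) erefl _) => _ [U oU <-].
rewrite setTI; apply: sub_sigma_algebra; exact: antipode_open.
Qed.

HB.instance Definition _ :=
  isMeasurableFun.Build _ _ _ _ antipode measurable_antipode.

Variable mu : probability (borel_sphere R n) R.

Definition symmetrisation : set (borel_sphere R n) -> \bar R :=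
  mscale (2^-1)%:nng (measure_add mu (distribution mu antipode)).

HB.instance Definition _ := Measure.on symmetrisation.

Lemma symmetrisationE A :
  symmetrisation A = ((2^-1)%:E * (mu A + mu (antipode @^-1` A)))%E.
Proof. by congr (_ * _)%E; exact: (measure_addE mu (distribution mu antipode)). Qed.

Let symmetrisation_setT : symmetrisation setT = 1%E.
Proof.
rewrite symmetrisationE preimage_setT probability_setT -EFinD -EFinM.
by congr (_%:E); lra.
Qed.

HB.instance Definition _ :=
  Measure_isProbability.Build _ _ _ symmetrisation symmetrisation_setT.

Lemma antipode_arc u v th ph :
  antipode @^-1` (sphere_arc u v th ph : set (sphere R n)) =
  sphere_arc u v (th + pi) (ph + pi).
Proof.
apply/seteqP; split=> y; rewrite /sphere_arc /= to_vec_antipode !dotNl.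
  by move=> h; apply/sectorDpi.
by move/sectorDpi.
Qed.

Lemma symmetrisation_arc_mass u v th ph :
  arc_mass symmetrisation u v th ph =
  (arc_mass mu u v th ph + arc_mass mu u v (th + pi) (ph + pi)) / 2.
Proof.
apply: EFin_inj; rewrite massK; last exact: arc_measurable.
apply: etrans (symmetrisationE _) _; rewrite antipode_arc.
rewrite mulrC EFinM EFinD; congr (_ * (_ + _))%E; apply/esym/massK;
  exact: arc_measurable.
Qed.

Lemma symmetrisation_arc_massDpi u v th ph :
  arc_mass symmetrisation u v (th + pi) (ph + pi) =
  arc_mass symmetrisation u v th ph.
Proof.
rewrite !symmetrisation_arc_mass addrC; congr ((_ + _) / 2).
by rewrite -[RHS]arc_mass2pi; congr arc_mass; lra.
Qed.

Lemma proper_symmetrisation :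
  proper_measure mu -> proper_measure symmetrisation.
Proof.
move=> [null pos]; split=> [H dH|U oU U0].
  apply: etrans (symmetrisationE _) _.
  rewrite (_ : antipode @^-1` _ = [set x : sphere R n | to_vec x \in H]).
    by rewrite null // adde0 mule0.
  by apply/seteqP; split=> x; rewrite /= to_vec_antipode memvN.
suff : (0 < symmetrisation U)%E by [].
rewrite symmetrisationE mule_gt0 // ?lte_fin ?invr_gt0 //.
by rewrite (lt_le_trans (pos _ oU U0)) // leeDl.
Qed.

End Symmetrisation.

(** * The two partition theorems *)

Section Ration.
Variables (R : realType) (k : nat) (alpha : 'I_(k + k) -> rat).
Hypothesis alphaP : ration alpha.

Definition ration_sum (t : nat) : R :=
  \sum_(i < k | (i < t)%N) ratr (alpha (lshift k i)).

Lemma ration_sum0 : ration_sum 0 = 0.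
Proof. by rewrite /ration_sum big_pred0. Qed.

Lemma ration_sumk : ration_sum k = 2^-1.
Proof.
have [_ _ half] := alphaP; rewrite /ration_sum.
under eq_bigl do rewrite ltn_ord.
by rewrite -rmorph_sum half fmorphV rmorph_nat.
Qed.

Lemma ration_sumS (t : 'I_k) :
  ration_sum t.+1 - ration_sum t = ratr (alpha (lshift k t)).
Proof.
rewrite /ration_sum (bigD1 t) //= -addrA -sumrN.
set s := \sum_(i < k | _ && _) _.
suff -> : s = \sum_(i < k | (i < t)%N) ratr (alpha (lshift k i)).
  by rewrite sumrN subrr addr0.
by apply: eq_bigl => i; rewrite ltnS ltn_neqAle andbC.
Qed.

Lemma ration_sum_lt t : (t < k)%N -> ration_sum t < ration_sum t.+1.
Proof.
move=> tk; rewrite -subr_gt0 (ration_sumS (Ordinal tk)) ltr0q.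
by have [pos _ _] := alphaP.
Qed.

End Ration.

Lemma alpha_partition_fan_of (R : realType) (n k j : nat)
    (alpha : 'I_(k + k) -> rat) (mu : 'I_j -> probability (borel_sphere R n) R)
    (i : 'I_j) (u v : 'rV[R]_n.+1) (th : nat -> R)
    (uu : dot u u = 1) (vv : dot v v = 1) (uv : dot u v = 0)
    (th_lt : forall t, (t < k + k)%N -> th t < th t.+1)
    (th_turn : th (k + k)%N = th 0 + 2 * pi) :
  ration alpha ->
  (forall t : 'I_k, arc_mass (mu i) u v (th t) (th t.+1) = ratr (alpha (lshift k t))) ->
  (forall (t : 'I_k) l, arc_mass (mu l) u v (th t) (th t.+1) =
    arc_mass (mu l) u v (th (k + t)%N) (th (k + t).+1)) ->
  alpha_partition alpha mu (orthant (fan_of uu vv uv th_lt th_turn)).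
Proof.
move=> [_ opp _] mass_i bal.
have massO m (t : 'I_(k + k)) :
    mu m (orthant (fan_of uu vv uv th_lt th_turn) t) =
    (arc_mass (mu m) u v (th t) (th t.+1))%:E.
  by rewrite orthant_fan_of massK //; exact: arc_measurable.
exists i; split=> [t|t l]; rewrite !massO.
  case: (splitP t) => t' /= e.
    have -> : t = lshift k t' by exact: val_inj.
    by rewrite mass_i.
  have -> : t = rshift k t' by exact: val_inj.
  by rewrite -bal mass_i opp.
by rewrite bal.
Qed.

(** The measure of index 0 is cut in the prescribed proportions, which makes it balanced,
    so only the j - 1 other measures are left to be balanced. *)
Theorem fan_partition (R : realType) (n k j : nat) (alpha : 'I_(k + k) -> rat)
    (mu : 'I_j -> probability (borel_sphere R n) R) :
  (0 < k)%N -> (0 < j)%N -> ration alpha -> (k * (j - 1) < n)%N ->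
  (forall l, proper_measure (mu l)) ->
  exists Phi : fan R n.+1 (k + k), alpha_partition alpha mu (orthant Phi).
Proof.
case: j mu => // j mu k0 _ al; rewrite subn1 /= => kj pm.
have [||||||u [v [th [[uu vv uv] th_lt th_turn mass_l bal]]]] :=
  @balanced_angles R n k (ration_sum R alpha) 'I_j (mu ord0)
    (fun l => mu (lift ord0 l)) k0.
- by rewrite card_ord.
- exact: pm.
- by move=> l; exact: pm.
- exact: ration_sum0.
- exact: ration_sumk.
- by move=> t; exact: ration_sum_lt.
exists (fan_of uu vv uv th_lt th_turn).
apply: (alpha_partition_fan_of (i := ord0)) => // t.
  by have [-> _] := mass_l t (ltn_ord t); rewrite ration_sumS.
move=> l; case: (unliftP ord0 l) => [l' ->|->]; first exact: bal.
by have [-> ->] := mass_l t (ltn_ord t).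
Qed.

(** The measure cut in the prescribed proportions is the symmetrisation of the measure of
    index 0. As opposite arcs have the same mass for it, the cuts come in opposite
    pairs, that is, they form an arrangement. All j measures are then balanced,
    including that of index 0, whose orthants therefore have the mass of their
    symmetrisation. *)
Theorem arrangement_partition (R : realType) (n k j : nat)
    (alpha : 'I_(k + k) -> rat) (mu : 'I_j -> probability (borel_sphere R n) R) :
  (0 < k)%N -> (0 < j)%N -> ration alpha -> (k * j < n)%N ->
  (forall l, proper_measure (mu l)) ->
  exists H : 'I_k -> {vspace 'rV[R]_n.+1}, arrangement_alpha_partition alpha mu H.
Proof.
move=> k0 j0 al kj pm; pose i0 := Ordinal j0.
pose nu : probability _ R := symmetrisation (mu i0).
have pnu : proper_measure nu by apply: proper_symmetrisation; exact: pm.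
have [||||||u [v [th [[uu vv uv] th_lt th_turn mass_nu bal]]]] :=
  @balanced_angles R n k (ration_sum R alpha) 'I_j nu mu k0.
- by rewrite card_ord.
- exact: pnu.
- exact: pm.
- exact: ration_sum0.
- exact: ration_sumk.
- by move=> t; exact: ration_sum_lt.
have fr := frame_uv uu vv uv.
have le := angles_le th_lt.
have kle t : (t <= k)%N -> (t <= k + k)%N by move=> h; rewrite (leq_trans h) ?leq_addr.
have p0 := pi_gt0 R.
have half a : arc_mass nu u v a (a + pi) = 2^-1.
  have := arc_mass_turn pnu a fr.
  rewrite (arc_mass_split pnu fr (ph := a + pi)); try lra.
  rewrite (_ : a + 2 * pi = a + pi + pi); last by ring.
  by rewrite symmetrisation_arc_massDpi; lra.
have sum t : (t <= k)%N -> arc_mass nu u v (th 0) (th t) = ration_sum R alpha t.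
  elim: t => [_|t IH tk]; first by rewrite arc_mass_empty // ration_sum0.
  rewrite (arc_mass_split pnu fr (ph := th t)) ?le ?kle ?(ltnW tk) //.
    by rewrite IH ?(ltnW tk) // (mass_nu t tk).1; ring.
  by rewrite -th_turn le // kle.
have opposite t : (t <= k)%N -> th (k + t)%N = th t + pi.
  elim: t => [_|t IH tk].
    rewrite addn0; apply: (arc_mass_inj pnu fr (th := th 0)).
    - by rewrite -th_turn !le ?leq_addr.
    - by apply/andP; split; lra.
    - by rewrite half sum // ration_sumk.
  have IHt := IH (ltnW tk); rewrite addnS.
  have ktk : (k + t < k + k)%N by rewrite ltn_add2l.
  apply: (arc_mass_inj pnu fr (th := th (k + t)%N)).
  - rewrite le ?leqnSn //=.
    apply: (@le_trans _ _ (th (k + k)%N)); first exact: le.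
    by rewrite th_turn lerD2r le // ltnW.
  - have tt : (t < k + k)%N by rewrite kle // ltnW.
    have := th_lt t tt; have : th t.+1 <= th (k + t)%N.
      by apply: le; [rewrite -addn1 addnC leq_add2r|exact: ltnW].
    by rewrite IHt => h1 h2; apply/andP; split; lra.
  - by rewrite (mass_nu t tk).2 IHt symmetrisation_arc_massDpi (mass_nu t tk).1.
exists (fun i : 'I_k => plane_at u v (th i)).
exists (fan_of uu vv uv th_lt th_turn); split.
  exact: (plane_at_position uu vv uv th_lt k0 erefl opposite).
apply: (alpha_partition_fan_of (i := i0)) => // t; last by move=> l; exact: bal.
have := (mass_nu t (ltn_ord t)).1.
rewrite symmetrisation_arc_mass -!opposite ?(ltnW (ltn_ord t)) // addnS -bal //.
by rewrite mulrDl -splitr ration_sumS.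
Qed.

(* The ambient dimension is d = n + 1, so that d - 1 = n. *)
Theorem theorem5 :
  (forall (R : realType) (n k j : nat) (alpha : 'I_(k + k) -> rat),
    (0 < k)%N -> (0 < j)%N -> ration alpha ->
    (k * (j - 1) < n)%N ->
    forall mu : 'I_j -> probability (borel_sphere R n) R,
      (forall l : 'I_j, proper_measure (mu l)) ->
      exists Phi : fan R n.+1 (k + k), alpha_partition alpha mu (orthant Phi))
  /\
  (forall (R : realType) (n k j : nat) (alpha : 'I_(k + k) -> rat),
    (0 < k)%N -> (0 < j)%N -> ration alpha ->
    (k * j < n)%N ->
    forall mu : 'I_j -> probability (borel_sphere R n) R,
      (forall l : 'I_j, proper_measure (mu l)) ->
      exists H : 'I_k -> {vspace 'rV[R]_n.+1},
        arrangement_alpha_partition alpha mu H).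
Proof.
split=> [R n k j al k0 j0 alP kj mu pm|R n k j al k0 j0 alP kj mu pm].
  exact: fan_partition.
exact: arrangement_partition.
Qed.
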